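(* Let $n\geq 2$ and let $\lambda \in \overline{\mathcal{P}}(n)$. Then the restriction of the $\mathbb{C}S_n$-supermodule $W^\lambda$ to $\mathbb{C}S_{n-1}$ satisfies (via even isomorphisms of $\mathbb{C}S_{n-1}$-supermodules) $$W^\lambda\!\downarrow_{\mathbb{C}S_{n-1}} \cong \Big[ \bigoplus_{\substack{\mu \prec \lambda \\ \mu \neq \mu'}} W^\mu \Big] \oplus \Big[ \bigoplus_{\substack{\mu \prec \lambda \\ \mu = \mu'}} \big(W^\mu \oplus \Pi(W^\mu)\big) \Big] \quad\text{if } \lambda \in E_n,$$ and $$W^\lambda\!\downarrow_{\mathbb{C}S_{n-1}} \cong \bigoplus_{\substack{\mu \prec \lambda \\ \operatorname{res}(\lambda/\mu) \geq 0}} W^\mu \quad\text{if } \lambda \in F_n.$$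
   Context: All vector spaces are over $\mathbb{C}$; ''super'' means $\mathbb{Z}_2$-graded, $V=V_{\overline 0}\oplus V_{\overline 1}$. The group algebra $\mathbb{C}S_n$ is a superalgebra with even part $\mathbb{C}A_n$ and odd part the span of the odd permutations. For a superalgebra $A$, $|A|$ denotes $A$ as an ordinary (ungraded) algebra. $\Pi(V)=\{v^\pi:v\in V\}$ denotes the parity shift of a supermodule, with $\Pi(V)_{\overline0}=V_{\overline1}$, $\Pi(V)_{\overline1}=V_{\overline0}$ and action $a.v^\pi=(a.v)^\pi$. $S_{n-1}\subset S_n$ is the subgroup fixing $n$. For a partition $\lambda$ of $n$, $\lambda'$ is the conjugate (transpose) partition and $S^\lambda$ is the Specht module (a simple $|\mathbb{C}S_n|$-module). $\overline{\mathcal{P}}(n)$ is a fixed set of representatives for the classes $\{\lambda,\lambda'\}$ of partitions of $n$; $E_n = \{\lambda\in\overline{\mathcal{P}}(n):\lambda\neq\lambda'\}$ and $F_n=\{\lambda\in\overline{\mathcal{P}}(n):\lambda=\lambda'\}$. For each $\lambda\vdash n$ fix a linear isomorphism $\phi^\lambda:S^\lambda\to S^{\lambda'}$ with $\phi^\lambda(\sigma v)=\operatorname{sgn}(\sigma)\,\sigma\phi^\lambda(v)$ for all $\sigma\in S_n$, $v\in S^\lambda$, chosen so that $\phi^{\lambda'}\circ\phi^\lambda=\mathrm{id}_{S^\lambda}$. For self-conjugate $\lambda$ this determines $\phi^\lambda$ up to sign, and the signs are assumed fixed coherently: whenever $\mu\prec\lambda$ with $\mu=\mu'$ and $\lambda=\lambda'$,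 the restriction of $\phi^\lambda$ to the copy of $S^\mu$ in $S^\lambda\!\downarrow_{S_{n-1}}$ equals $\phi^\mu$. For $\lambda=\lambda'$, let $S^{\lambda^+}$, $S^{\lambda^-}$ be the $+1$ and $-1$ eigenspaces of $\phi^\lambda$. $W^\lambda$ is the following simple $\mathbb{C}S_n$-supermodule. For $\lambda\neq\lambda'$: $W^\lambda=S^\lambda\oplus S^{\lambda'}$ as a $|\mathbb{C}S_n|$-module, with $W^\lambda_{\overline0}=\{u+\phi^\lambda(u):u\in S^\lambda\}$, $W^\lambda_{\overline1}=\{u-\phi^\lambda(u):u\in S^\lambda\}$ (up to even isomorphism it depends only on $\{\lambda,\lambda'\}$). For $\lambda=\lambda'$: $W^\lambda=S^\lambda$ as a $|\mathbb{C}S_n|$-module, with $W^\lambda_{\overline0}=S^{\lambda^+}$, $W^\lambda_{\overline1}=S^{\lambda^-}$. The same notation is used for $n-1$; for $n=2$, $W^{(1)}$ means the one-dimensional trivial module $\mathbb{C}$ in even degree. For $\lambda\vdash n$ and $\mu\vdash n-1$, $\mu\prec\lambda$ means that the Young diagram of $\mu$ is obtained by removing one box from that of $\lambda$. The box in row $i$ and column $j$ has residue $j-i$, and $\operatorname{res}(\lambda/\mu)$ is the residue of the removed box. *)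

(* Defs.v *)
From HB Require Import structures.
From mathcomp Require Import all_boot all_order all_fingroup all_algebra.
From mathcomp Require Import reals complex.
Set Implicit Arguments.
Unset Strict Implicit.
Unset Printing Implicit Defensive.
Import Order.TTheory GRing.Theory Num.Theory.
Local Open Scope ring_scope.

(* Conventions.
   - The group 'S_n permutes 'I_n = {0, ..., n-1}, so the letter called n in
     1-based notation is ord_max.
   - The product of 'S_n is (s * t)%g = t \o s.  A left module over the
     group algebra C S_n, formed with the usual composition of permutations,
     therefore satisfies (s * t).v = t.(s.v).
   - A module over C S_n is given by the action of the basis 'S_n.  Its
     grading is indexed by bool: false is the even degree, true the odd one,
     and a permutation s is homogeneous of degree odd_perm s.
   - Rows, columns and boxes are numbered from 0; this does not change
     residues. *)

Section Partitions.
Local Open Scope nat_scope.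

(* Partitions of n, padded with zeros to exactly n rows. *)
Definition is_intpart n (p : {ffun 'I_n -> 'I_n.+1}) :=
  [forall i : 'I_n, forall j : 'I_n, (i <= j) ==> (p j <= p i)] && (\sum_i p i == n).

Definition intpart n := {p : {ffun 'I_n -> 'I_n.+1} | is_intpart p}.

Definition rowlen n (la : intpart n) (i : nat) : nat :=
  if insub i is Some k then sval la k else 0.

(* The diagram of la inside an N x N box; it is complete as soon as n <= N. *)
Definition diag N n (la : intpart n) : {set 'I_N * 'I_N} :=
  [set b : 'I_N * 'I_N | b.2 < rowlen la b.1].

Lemma row_le n (la : intpart n) i : rowlen la i <= n.
Proof. by rewrite /rowlen; case: insub => [k|] //; rewrite -ltnS ltn_ord. Qed.

Lemma row_ord n (la : intpart n) (i : 'I_n) : rowlen la i = sval la i.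
Proof. by rewrite /rowlen valK. Qed.

Definition conj_row n (la : intpart n) (j : nat) : nat :=
  #|[set i : 'I_n | j < rowlen la i]|.

Lemma conj_rowP n (la : intpart n) :
  is_intpart [ffun j : 'I_n => inord (conj_row la j) : 'I_n.+1].
Proof.
have le_n j : conj_row la j < n.+1.
  by rewrite ltnS -[X in _ <= X]card_ord max_card.
apply/andP; split.
  apply/forallP=> i; apply/forallP=> j; apply/implyP=> le_ij.
  rewrite !ffunE !inordK //; apply/subset_leq_card/subsetP=> k.
  by rewrite !inE; apply: leq_ltn_trans.
apply/eqP; have /andP[_ /eqP sum_la] := svalP la.
rewrite -[RHS]sum_la.
transitivity (\sum_(j < n) \sum_(i < n) (j < rowlen la i)).
  apply: eq_bigr => j _; rewrite ffunE inordK // /conj_row -sum1_card big_mkcond.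
  by apply: eq_bigr => i _; rewrite inE; case: ifP.
rewrite exchange_big; apply: eq_bigr => i _ /=; rewrite -row_ord.
rewrite -[RHS]card_ord -sum1_card (big_ord_widen n (fun _ => 1) (row_le la i)).
by rewrite [RHS]big_mkcond; apply: eq_bigr => j _; case: ifP.
Qed.

Definition conj_part n (la : intpart n) : intpart n :=
  exist (@is_intpart n) _ (conj_rowP la).

Lemma card_ltn n k : k <= n -> #|[set i : 'I_n | i < k]| = k.
Proof.
move=> le_kn; rewrite -sum1_card (eq_bigl (fun i : 'I_n => i < k)).
  by rewrite -(big_ord_widen n (fun _ => 1) le_kn) sum1_card card_ord.
by move=> i; rewrite inE.
Qed.

Lemma row_decr n (la : intpart n) a b : a <= b -> rowlen la b <= rowlen la a.
Proof.
move=> le_ab; rewrite {1}/rowlen; case: insubP => //= b' lt_b Eb.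
have lt_a : a < n by apply: leq_ltn_trans lt_b.
rewrite /rowlen insubT /=.
have /andP[/forallP/(_ (Ordinal lt_a))/forallP/(_ b')/implyP h _] := svalP la.
by apply: h; rewrite Eb.
Qed.

Lemma row_conj n (la : intpart n) i : rowlen (conj_part la) i = conj_row la i.
Proof.
rewrite {1}/rowlen; case: insubP => [k lt_k <-|le_i].
  by rewrite /= ffunE inordK // ltnS -[X in _ <= X]card_ord max_card.
apply/esym/eqP; rewrite cards_eq0; apply/eqP/setP=> k; rewrite !inE.
apply/negbTE; rewrite -leqNgt; apply: leq_trans (row_le la k) _.
by rewrite leqNgt.
Qed.

Lemma ltn_row_conj n (la : intpart n) i j :
  (j < rowlen (conj_part la) i) = (i < rowlen la j).
Proof.
rewrite row_conj /conj_row; case: (ltnP i (rowlen la j)) => h.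
  have lt_j : j < n by move: h; rewrite /rowlen; case: insubP.
  rewrite -[X in X <= _](card_ltn lt_j).
  apply/subset_leq_card/subsetP=> k; rewrite !inE ltnS => le_kj.
  exact: leq_trans h (row_decr _ _).
apply/negbTE; rewrite -leqNgt.
have [le_nj|lt_jn] := leqP n j.
  by apply: leq_trans le_nj; rewrite -[X in _ <= X]card_ord max_card.
rewrite -[X in _ <= X](card_ltn (ltnW lt_jn)).
apply/subset_leq_card/subsetP=> k; rewrite !inE => lt_ik.
rewrite ltnNge; apply/negP=> /(row_decr la)/(leq_trans lt_ik).
by rewrite ltnNge h.
Qed.

Lemma conjK n : involutive (@conj_part n).
Proof.
move=> la; apply/val_inj/ffunP=> i; apply/val_inj.
change (sval (conj_part (conj_part la)) i = sval la i :> nat); rewrite -!row_ord.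
apply/eqP; rewrite eqn_leq; apply/andP; split.
  by case E: (rowlen (conj_part (conj_part la)) i) => [|k] //; rewrite -2!ltn_row_conj E.
by case E: (rowlen la i) => [|k] //; rewrite 2!ltn_row_conj E.
Qed.

Lemma mem_diag_conj N n (la : intpart n) (i j : 'I_N) :
  ((i, j) \in diag N (conj_part la)) = ((j, i) \in diag N la).
Proof. by rewrite !inE ltn_row_conj. Qed.

Definition removed m (mu : intpart m) (la : intpart m.+1) (b : 'I_m.+1 * 'I_m.+1) :=
  (b \in diag m.+1 la) && (diag m.+1 mu == diag m.+1 la :\ b).

Definition prec m (mu : intpart m) (la : intpart m.+1) :=
  [exists b, removed mu la b].

(* Column minus row of the removed box; junk value 0 when mu is not obtained
   from la by removing a box. *)
Definition residue m (la : intpart m.+1) (mu : intpart m) : int :=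
  if [pick b | removed mu la b] is Some b then Posz b.2 - Posz b.1 else 0.

Definition conj_reps n (P : {set intpart n}) :=
  forall la : intpart n, #|P :&: [set la; conj_part la]| = 1.

Definition E_ n (P : {set intpart n}) := [set la in P | la != conj_part la].
Definition F_ n (P : {set intpart n}) := [set la in P | la == conj_part la].

End Partitions.

Section Modules.
Variable C : numFieldType.

Record snmod n := Snmod {
  mcar :> vectType C;
  mact : 'S_n -> mcar -> mcar;
  mact_lin : forall s, linear (mact s);
  mact1 : forall u, mact 1%g u = u;
  mactM : forall s t u, mact (s * t)%g u = mact t (mact s u) }.

Record supermod n := Supermod {
  smod :> snmod n;
  spart : bool -> {vspace smod};
  spart_full : (spart false + spart true)%VS = fullv;
  spart_direct : (spart false :&: spart true)%VS = 0%VS;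
  spart_act : forall (s : 'S_n) b u,
    u \in spart b -> mact s u \in spart (s (+) b) }.

Definition equivariant n (V W : snmod n) (f : V -> W) :=
  forall s u, f (mact s u) = mact s (f u).

Definition even_iso n (V W : supermod n) : Prop :=
  exists f : 'Hom(V, W),
    [/\ bijective f, equivariant f
      & forall b u, u \in spart V b -> f u \in spart W b].

Section Zero.
Variable n : nat.

Definition mod0 : snmod n :=
  @Snmod n 'rV[C]_0 (fun _ u => u)
    (fun _ _ _ _ => erefl) (fun _ => erefl) (fun _ _ _ => erefl).

Fact super0_full : (0 + 0)%VS = (fullv : {vspace mod0}).
Proof. by apply/vspaceP=> u; rewrite memvf [u]thinmx0 mem0v. Qed.

Definition super0 : supermod n :=
  @Supermod n mod0 (fun _ => 0%VS) super0_full (capvv _) (fun _ _ _ h => h).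
End Zero.

Section ParityShift.
Variables (n : nat) (V : supermod n).

Fact shift_full : (spart V true + spart V false)%VS = fullv.
Proof. by rewrite addvC spart_full. Qed.

Fact shift_direct : (spart V true :&: spart V false)%VS = 0%VS.
Proof. by rewrite capvC spart_direct. Qed.

Fact shift_act (s : 'S_n) b u :
  u \in spart V (~~ b) -> mact s u \in spart V (~~ (s (+) b)).
Proof. by move/(spart_act s); rewrite addbN. Qed.

Definition Pi : supermod n :=
  @Supermod n V (fun b => spart V (~~ b)) shift_full shift_direct shift_act.
End ParityShift.

Section DirectSumModule.
Variables (n : nat) (V W : snmod n).

Definition dsum_act (s : 'S_n) (u : V * W) : V * W :=
  (mact s u.1, mact s u.2).

Fact dsum_lin s : linear (dsum_act s).
Proof. by move=> k [u1 u2] [v1 v2]; congr pair; apply: mact_lin. Qed.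

Fact dsum1 u : dsum_act 1%g u = u.
Proof. by case: u => u1 u2; rewrite /dsum_act !mact1. Qed.

Fact dsumM s t u : dsum_act (s * t)%g u = dsum_act t (dsum_act s u).
Proof. by rewrite /dsum_act /= !mactM. Qed.

Definition dsum_mod : snmod n :=
  @Snmod n (V * W)%type dsum_act dsum_lin dsum1 dsumM.
End DirectSumModule.

Section DirectSum.
Variables (n : nat) (V W : supermod n).

Definition dsum_part b : {vspace dsum_mod V W} :=
  (linfun fst @^-1: spart V b :&: linfun snd @^-1: spart W b)%VS.

Lemma mem_dsum_part b (u : V * W) :
  (u \in dsum_part b) = (u.1 \in spart V b) && (u.2 \in spart W b).
Proof. by rewrite memv_cap -!memv_preim !lfunE. Qed.

Fact dsum_full : (dsum_part false + dsum_part true)%VS = fullv.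
Proof.
apply/vspaceP=> -[u1 u2]; rewrite memvf.
have /memv_addP[a1 Ha1 [b1 Hb1 ->]] : u1 \in (spart V false + spart V true)%VS.
  by rewrite spart_full memvf.
have /memv_addP[a2 Ha2 [b2 Hb2 ->]] : u2 \in (spart W false + spart W true)%VS.
  by rewrite spart_full memvf.
apply/memv_addP; exists (a1, a2); first by rewrite mem_dsum_part Ha1.
by exists (b1, b2); first by rewrite mem_dsum_part Hb1.
Qed.

Fact dsum_direct : (dsum_part false :&: dsum_part true)%VS = 0%VS.
Proof.
apply/vspaceP=> -[u1 u2].
rewrite memv_cap !mem_dsum_part /= andbACA -!memv_cap !spart_direct !memv0.
by rewrite -xpair_eqE.
Qed.

Fact dsum_part_act (s : 'S_n) b u :
  u \in dsum_part b -> dsum_act s u \in dsum_part (s (+) b).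
Proof.
by rewrite !mem_dsum_part => /andP[? ?]; rewrite !spart_act.
Qed.

Definition dsum : supermod n :=
  @Supermod n (dsum_mod V W) dsum_part dsum_full dsum_direct dsum_part_act.
End DirectSum.

Section Restriction.
Variable m : nat.

(* The embedding of S_(n-1) into S_n as the stabilizer of the last letter. *)
Definition emb (s : 'S_m) : 'S_m.+1 := lift_perm ord_max ord_max s.

Fact res_act1 (V : snmod m.+1) (u : V) : mact (emb 1%g) u = u.
Proof. by rewrite /emb lift_perm1 mact1. Qed.

Fact res_actM (V : snmod m.+1) s t (u : V) :
  mact (emb (s * t)%g) u = mact (emb t) (mact (emb s) u).
Proof. by rewrite -mactM /emb lift_permM. Qed.

Definition res_mod (V : snmod m.+1) : snmod m :=
  @Snmod m V (fun s => mact (emb s)) (fun s => mact_lin (emb s))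
    (@res_act1 V) (@res_actM V).

Fact res_part_act (V : supermod m.+1) (s : 'S_m) b u :
  u \in spart V b -> mact (emb s) u \in spart V (s (+) b).
Proof. by move/(spart_act (emb s)); rewrite odd_lift_perm addbb. Qed.

Definition res_super (V : supermod m.+1) : supermod m :=
  @Supermod m (res_mod V) (spart V) (spart_full V) (spart_direct V)
    (@res_part_act V).
End Restriction.

Section Specht.
Variable n : nat.

(* A tabloid is encoded by the function sending each letter to its row.
   All the permutation modules M^la, hence all the Specht modules, live in the
   free vector space on the row functions; in particular S^la and S^(la') are
   literally equal when la = la'. *)
Definition ambient : vectType C := {ffun {ffun 'I_n -> 'I_n} -> C^o}.

Definition basis_vec (r : {ffun 'I_n -> 'I_n}) : ambient :=
  [ffun x => (x == r)%:R].

(* Letters are permuted: s sends the basis vector of r to that of r \o s^-1. *)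
Definition perm_act (s : 'S_n) (v : ambient) : ambient :=
  [ffun r : {ffun 'I_n -> 'I_n} => v [ffun k => r (s k)]].

Lemma perm_act_basis s r :
  perm_act s (basis_vec r) = basis_vec [ffun k => r (s^-1 k)%g].
Proof.
apply/ffunP=> x; rewrite !ffunE; congr (_%:R); congr nat_of_bool.
apply/eqP/eqP=> [<-|->]; apply/ffunP=> k; rewrite !ffunE.
  by rewrite permKV.
by rewrite permK.
Qed.

Fact perm_act_lin s : linear (perm_act s).
Proof. by move=> k u v; apply/ffunP=> r; rewrite !ffunE. Qed.
HB.instance Definition _ s :=
  GRing.isLinear.Build C ambient ambient _ (perm_act s) (perm_act_lin s).

Lemma perm_act1 v : perm_act 1%g v = v.
Proof.
by apply/ffunP=> r; rewrite ffunE; congr (v _); apply/ffunP=> k;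
  rewrite ffunE perm1.
Qed.

Lemma perm_actM s t v : perm_act (s * t)%g v = perm_act t (perm_act s v).
Proof.
apply/ffunP=> r; rewrite !ffunE; congr (v _); apply/ffunP=> k.
by rewrite !ffunE permM.
Qed.

(* A tableau sends each letter to the box it occupies. *)
Definition tableau (la : intpart n) (t : {ffun 'I_n -> 'I_n * 'I_n}) :=
  injectiveb t && [forall k, t k \in diag n la].

Definition tabloid (t : {ffun 'I_n -> 'I_n * 'I_n}) : {ffun 'I_n -> 'I_n} :=
  [ffun k => (t k).1].

Definition colstab (t : {ffun 'I_n -> 'I_n * 'I_n}) : {set 'S_n} :=
  [set s : 'S_n | [forall k, (t (s k)).2 == (t k).2]].

Definition polytabloid (t : {ffun 'I_n -> 'I_n * 'I_n}) : ambient :=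
  \sum_(s in colstab t) (-1) ^+ s *: perm_act s (basis_vec (tabloid t)).

Definition specht_space (la : intpart n) : {vspace ambient} :=
  <<[seq polytabloid t | t <- enum [pred t | tableau la t]]>>%VS.

Lemma perm_act_polytabloid (s : 'S_n) t :
  perm_act s (polytabloid t) = polytabloid [ffun k => t (s^-1 k)%g].
Proof.
rewrite /polytabloid linear_sum /=.
rewrite [RHS](reindex_inj (conjg_inj s)) /=.
apply: eq_big => [x|x _]; last first.
  rewrite linearZ /= odd_permJ -!perm_actM; congr (_ *: _).
  have -> : tabloid [ffun k => t (s^-1 k)%g]
          = [ffun k => tabloid t (s^-1 k)%g].
    by apply/ffunP=> k; rewrite !ffunE.
  by rewrite -perm_act_basis -perm_actM conjgE !mulgA mulgV mul1g.
rewrite !inE; apply/forallP/forallP=> h k; rewrite ?ffunE.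
  by rewrite conjgE !permM permK; apply: h.
have := h (s k); rewrite !ffunE permK.
by rewrite conjgE !permM !permK.
Qed.

Lemma tableau_perm la (s : 'S_n) t :
  tableau la t -> tableau la [ffun k => t (s^-1 k)%g].
Proof.
case/andP=> /injectiveP inj_t /forallP dt; apply/andP; split.
  by apply/injectiveP=> i j; rewrite !ffunE => /inj_t/perm_inj.
by apply/forallP=> k; rewrite ffunE.
Qed.

Lemma specht_stable la s v :
  v \in specht_space la -> perm_act s v \in specht_space la.
Proof.
suff /subvP sub : (specht_space la <= linfun (perm_act s) @^-1: specht_space la)%VS.
  by move/sub; rewrite -memv_preim lfunE.
apply/span_subvP=> _ /mapP[t + ->]; rewrite mem_enum inE => Tt.
rewrite -memv_preim lfunE /=.
rewrite perm_act_polytabloid; apply: memv_span; apply: map_f.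
by rewrite mem_enum inE; apply: tableau_perm.
Qed.

Section Module.
Variable la : intpart n.
Let S := subvs_of (specht_space la).

Definition specht_act (s : 'S_n) (u : S) : S :=
  Subvs (specht_stable s (subvsP u)).

Fact specht_act_lin s : linear (specht_act s).
Proof. by move=> k u v; apply/val_inj; rewrite /= !linearP. Qed.

Fact specht_act1 u : specht_act 1%g u = u.
Proof. by apply/val_inj; rewrite /= perm_act1. Qed.

Fact specht_actM s t u :
  specht_act (s * t)%g u = specht_act t (specht_act s u).
Proof. by apply/val_inj; rewrite /= perm_actM. Qed.

Definition specht : snmod n :=
  @Snmod n S specht_act specht_act_lin specht_act1 specht_actM.
End Module.
End Specht.

Definition amb n (la : intpart n) (u : specht la) : ambient n := vsval u.

(* The family phi^la : S^la -> S^(la').  Bijectivity follows from phi_inv.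
   The types S^(conj_part (conj_part la)) and S^la, as well as S^(conj_part la) and S^la for
   a self-conjugate la, are only propositionally equal, so elements are compared
   in the ambient space.  In phi_coh the copy of S^mu in the restriction of
   S^la is the image of an embedding i, and v stands for phi^mu(u). *)
Record assoc_family := AssocFamily {
  phi :> forall n (la : intpart n), 'Hom(specht la, specht (conj_part la));
  phi_sgn : forall n (la : intpart n) (s : 'S_n) (u : specht la),
    phi la (mact s u) = (-1) ^+ s *: mact s (phi la u);
  phi_inv : forall n (la : intpart n) (u : specht la),
    amb (phi (conj_part la) (phi la u)) = amb u;
  phi_coh : forall m (mu : intpart m) (la : intpart m.+1),
    prec mu la -> mu = conj_part mu -> la = conj_part la ->
    forall i : 'Hom(specht mu, res_mod (specht la)),
      injective i -> equivariant i ->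
    forall u v : specht mu, amb (phi mu u) = amb v ->
      amb (phi la (i u)) = amb (i v : specht la) }.

Section AssocFamily.
Variable f : assoc_family.

Lemma amb_act n (la : intpart n) s (u : specht la) :
  amb (mact s u) = perm_act s (amb u).
Proof. by []. Qed.

Lemma amb_cast n (la nu : intpart n) (u : specht la) :
  la = nu -> exists u' : specht nu, amb u' = amb u.
Proof. by move=> <-; exists u. Qed.

Lemma phi_inj n (la : intpart n) : injective (f n la).
Proof.
move=> u v e; apply/val_inj; change (amb u = amb v).
by rewrite -(phi_inv f u) e phi_inv.
Qed.

Lemma phi_surj n (la : intpart n) (v : specht (conj_part la)) : exists u, f n la u = v.
Proof.
have [u Eu] := amb_cast (f n (conj_part la) v) (conjK la).
exists u; apply/(@phi_inj n (conj_part la))/val_inj.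
by change (amb (f n (conj_part la) (f n la u)) = amb (f n (conj_part la) v)); rewrite phi_inv.
Qed.

Lemma phi_cast n (la nu : intpart n) (u : specht la) (v : specht nu) :
  la = nu -> amb u = amb v -> amb (f n la u) = amb (f n nu v).
Proof. by move=> e; move: v; rewrite -e => v /val_inj->. Qed.

Section W.
Variables (n : nat) (la : intpart n).

Section NonSelfConjugate.
Let M := dsum_mod (specht la) (specht (conj_part la)).

Definition graph (b : bool) (u : specht la) : M := (u, (-1) ^+ b *: f n la u).

Fact graph_lin b : linear (graph b).
Proof.
move=> k u v; congr pair => //=.
by rewrite linearP /= scalerDr !scalerA mulrC.
Qed.
HB.instance Definition _ b :=
  GRing.isLinear.Build C (specht la) M _ (graph b) (graph_lin b).

Definition pair_part b : {vspace M} := limg (linfun (graph b)).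

Lemma pair_partP b (w : M) :
  reflect (exists u, w = graph b u) (w \in pair_part b).
Proof.
by apply: (iffP memv_imgP) => [[u _ ->]|[u ->]]; exists u;
  rewrite ?memvf ?lfunE.
Qed.

Fact pair_full : (pair_part false + pair_part true)%VS = fullv.
Proof.
have h2 : (2%:R : C) != 0 by rewrite pnatr_eq0.
apply/vspaceP=> -[u v]; rewrite memvf; have [w Ew] := phi_surj v.
apply/memv_addP.
exists (graph false (2%:R^-1 *: (u + w))); first by apply/pair_partP; eexists.
exists (graph true (2%:R^-1 *: (u - w))); first by apply/pair_partP; eexists.
rewrite /graph -Ew; congr pair => /=.
  rewrite -scalerDr addrACA subrr addr0 -mulr2n -scaler_nat scalerA.
  by rewrite mulVf ?scale1r.
rewrite expr0 expr1 scale1r scaleN1r !linearZ !linearD linearN /=.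
rewrite opprK -scalerDr addrACA subrr add0r -mulr2n -scaler_nat scalerA.
by rewrite mulVf ?scale1r.
Qed.

Fact pair_direct : (pair_part false :&: pair_part true)%VS = 0%VS.
Proof.
have h2 : (2%:R : C) != 0 by rewrite pnatr_eq0.
apply/vspaceP=> w; rewrite memv_cap memv0; apply/andP/eqP; last first.
  by move=> ->; rewrite !mem0v.
case=> /pair_partP[u ->] /pair_partP[v e].
have euv : u = v := congr1 fst e; move: (congr1 snd e); rewrite -euv.
rewrite /= expr0 expr1 scale1r scaleN1r => /eqP.
rewrite -addr_eq0 -mulr2n -scaler_nat scaler_eq0 (negbTE h2) /= => /eqP Eu.
have u0 : u = 0 by apply: (@phi_inj n la); rewrite Eu linear0.
by rewrite /graph Eu scaler0 u0.
Qed.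

Fact pair_part_act (s : 'S_n) b (w : M) :
  w \in pair_part b -> mact s w \in pair_part (s (+) b).
Proof.
case/pair_partP=> u ->; apply/pair_partP; exists (mact s u).
congr pair => /=; rewrite phi_sgn scalerA -signr_addb addbAC addbb addFb.
by apply/val_inj; rewrite /= linearZ.
Qed.

Definition W_pair : supermod n :=
  @Supermod n M pair_part pair_full pair_direct pair_part_act.
End NonSelfConjugate.

Section SelfConjugate.
Hypothesis la_self : la = conj_part la.

(* The (-1)^b-eigenspace of phi^la. *)
Definition self_part (b : bool) : {vspace specht la} :=
  lker (linfun vsval \o f n la - (-1) ^+ b *: linfun vsval)%VF.

Lemma self_partP (b : bool) (u : specht la) :
  reflect (amb (f n la u) = (-1) ^+ b *: amb u) (u \in self_part b).
Proof.
by rewrite memv_ker !lfun_simp /= subr_eq0; apply: eqP.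
Qed.

Fact self_full : (self_part false + self_part true)%VS = fullv.
Proof.
have h2 : (2%:R : C) != 0 by rewrite pnatr_eq0.
apply/vspaceP=> u; rewrite memvf.
have [u' Eu'] := amb_cast (f n la u) (esym la_self).
have Eu : amb (f n la u') = amb u by rewrite (phi_cast la_self Eu') phi_inv.
have part_b (b : bool) : 2%:R^-1 *: (u + (-1) ^+ b *: u') \in self_part b.
  apply/self_partP; rewrite linearZ linearD linearZ /=.
  change (2%:R^-1 *: (amb (f n la u) + (-1) ^+ b *: amb (f n la u'))
    = (-1) ^+ b *: (2%:R^-1 *: (amb u + (-1) ^+ b *: amb u'))).
  rewrite Eu -Eu'.
  rewrite [RHS]scalerA [_ * 2%:R^-1]mulrC -[RHS]scalerA; congr (_ *: _).
  rewrite [RHS]scalerDr scalerA -signr_addb addbb.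
  by rewrite scale1r addrC.
apply/memv_addP; exists (2%:R^-1 *: (u + (-1) ^+ false *: u')) => //.
exists (2%:R^-1 *: (u + (-1) ^+ true *: u')) => //.
rewrite expr0 expr1 scale1r scaleN1r.
rewrite -scalerDr addrACA subrr addr0 -mulr2n -scaler_nat scalerA.
by rewrite mulVf ?scale1r.
Qed.

Fact self_direct : (self_part false :&: self_part true)%VS = 0%VS.
Proof.
have h2 : (2%:R : C) != 0 by rewrite pnatr_eq0.
apply/vspaceP=> u; rewrite memv_cap memv0; apply/andP/eqP; last first.
  by move=> ->; split; apply: mem0v.
case=> /self_partP e0 /self_partP e1; apply/val_inj.
have : amb u = - amb u by rewrite -scaleN1r -[LHS]scale1r -(etrans (esym e0) e1).
move/eqP; rewrite -addr_eq0 -mulr2n -scaler_nat scaler_eq0 (negbTE h2).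
by move/eqP.
Qed.

Fact self_part_act (s : 'S_n) b (u : specht la) :
  u \in self_part b -> mact s u \in self_part (s (+) b).
Proof.
move/self_partP=> Eu; apply/self_partP; rewrite phi_sgn.
change ((-1) ^+ s *: perm_act s (amb (f n la u))
  = (-1) ^+ (s (+) b) *: perm_act s (amb u)).
by rewrite Eu linearZ /= scalerA -signr_addb.
Qed.

Definition W_self : supermod n :=
  @Supermod n (specht la) self_part self_full self_direct self_part_act.
End SelfConjugate.

End W.

Definition triv1 : snmod 1 :=
  @Snmod 1 C^o (fun _ u => u)
    (fun _ _ _ _ => erefl) (fun _ => erefl) (fun _ _ _ => erefl).

Definition triv1_part (b : bool) : {vspace triv1} :=
  if b then 0%VS else fullv.

Fact triv1_full : (triv1_part false + triv1_part true)%VS = fullv.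
Proof. exact: addv0. Qed.

Fact triv1_direct : (triv1_part false :&: triv1_part true)%VS = 0%VS.
Proof. exact: capv0. Qed.

Fact triv1_act (s : 'S_1) b (u : triv1) :
  u \in triv1_part b -> mact s u \in triv1_part (s (+) b).
Proof.
have -> : s = 1%g by apply/permP=> i; rewrite !ord1.
by rewrite odd_perm1.
Qed.

Definition super_triv1 : supermod 1 :=
  @Supermod 1 triv1 triv1_part triv1_full triv1_direct triv1_act.

Definition W_gen n (la : intpart n) : supermod n :=
  match la =P conj_part la with
  | ReflectT e => W_self e
  | ReflectF _ => W_pair la
  end.

(* The only partition of 1 is treated apart: W^(1) is the trivial module in
   even degree, whatever the sign of phi^(1). *)
Definition W n : intpart n -> supermod n :=
  match n with
  | 1 => fun _ => super_triv1
  | k => @W_gen k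
  end.

End AssocFamily.
End Modules.

(* Main.v *)
Require Import Defs.
From HB Require Import structures.
From mathcomp Require Import all_boot all_order all_fingroup all_algebra.
From mathcomp Require Import reals complex zify.
Set Implicit Arguments.
Unset Strict Implicit.
Unset Printing Implicit Defensive.
Import Order.TTheory GRing.Theory Num.Theory.
Local Open Scope ring_scope.

(* Inside the space of functions on words in the rows, S^la consists of the
   vectors of weight la killed by all raising operators of gl_N (James).  Sort
   the words by the row of the last letter n.  The lowest nonzero component of
   such a highest weight vector is again one, for S_(n-1), so its weight is la
   with a removable box deleted.  On that component the Jucys-Murphy element
   X = sum of the (k n) acts by the residue of the deleted box.  As residues of
   removable boxes are distinct, X splits S^la into eigenspaces isomorphic to
   the S^mu.  No irreducibility is needed: phi^la anticommutes with X, hence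
   exchanges the eigenspaces of residues c and -c, and the coherence of the
   signs settles c = 0. *)

(* Keeps mathcomp's homonymous constant on group actions out of the way. *)
Local Notation mact := Defs.mact.

(** * Words and raising operators *)

(** A Specht module is given by generators whose relations are not at hand, which makes maps between
    Specht modules hard to define. The kernel theorem trades generators for equations: a vector lies
    in S^mu as soon as it has the right weight and is killed by the raising operators. This is how
    the projections S^la -> S^mu are obtained. The grading enters in one way only. Each mu
    contributes a pair (a, b) of vectors of S^mu: for la != la' the projections of the two halves,
    the second brought back by the inverse of phi^la; for la = la' the projections of v and of
    phi^la(v). A vector of degree d gives b = (-1)^d a, and sigma acts on b with an extra sign, so
    both cases lead to the same supermodule of pairs. Only when la and mu are both self-conjugate is
    b determined by a, and there coherence is needed. *)

Lemma big_ord_lift (R : Type) (idx : R) (op : Monoid.law idx) m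
    (P : pred 'I_m.+1) (F : 'I_m.+1 -> R) :
  \big[op/idx]_(k | P k) F k =
  op (\big[op/idx]_(k | P (lift ord_max k)) F (lift ord_max k))
     (if P ord_max then F ord_max else idx).
Proof.
rewrite big_mkcond big_ord_recr [X in _ = op X _]big_mkcond; congr (op _ _).
apply: eq_bigr => k _; suff -> : widen_ord (leqnSn m) k = lift ord_max k by [].
by apply/val_inj; rewrite /= /bump leqNgt ltn_ord.
Qed.

Section Words.
Variables (C : numClosedFieldType) (n N : nat).
Implicit Types (r : {ffun 'I_n -> 'I_N}) (v : {ffun 'I_n -> 'I_N} -> C).

Definition upd r k (i : 'I_N) : {ffun 'I_n -> 'I_N} :=
  [ffun x => if x == k then i else r x].

(* For j < i this is the raising operator moving one letter from row i to
   row j, that is, the matrix unit E_ji of gl_N in Schur-Weyl duality. *)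
Definition move (j i : 'I_N) v r : C := \sum_(k | r k == j) v (upd r k i).

Definition cnt r (i : nat) : nat := #|[set k | r k == i :> nat]|.

Definition weight (a : nat -> nat) v :=
  forall r, v r != 0 -> forall i : 'I_N, cnt r i = a i.

Definition highest (a : nat -> nat) v :=
  weight a v /\ forall j i : 'I_N, (j < i)%N -> forall r, move j i v r = 0.

Lemma upd_id r k : upd r k (r k) = r.
Proof. by apply/ffunP=> x; rewrite ffunE; case: eqP => // ->. Qed.

Lemma updE r k i : upd r k i k = i.
Proof. by rewrite ffunE eqxx. Qed.

Lemma updN r k i x : x != k -> upd r k i x = r x.
Proof. by rewrite ffunE => /negbTE->. Qed.

Lemma upd_upd r k i j : upd (upd r k i) k j = upd r k j.
Proof. by apply/ffunP=> x; rewrite !ffunE; case: eqP. Qed.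

Lemma updC r k l i j : k != l -> upd (upd r k i) l j = upd (upd r l j) k i.
Proof.
move=> /negbTE neq; apply/ffunP=> x; rewrite !ffunE.
by case: (x =P l) => // ->; rewrite eq_sym neq.
Qed.

Lemma cntE r (i : 'I_N) : (cnt r i)%:R = \sum_(k | r k == i) 1 :> C.
Proof. by rewrite /cnt -sum1dep_card natr_sum; apply: eq_bigl => k. Qed.

Lemma move_ext j i v w : v =1 w -> move j i v =1 move j i w.
Proof. by move=> e r; apply: eq_bigr => k _. Qed.

(** Substituting a row at letter k is reversible, so E_ij and E_ji are transposes for the bilinear
    form in which the words are orthonormal. *)
Lemma move_adj i j v w :
  \sum_r move i j v r * w r = \sum_r v r * move j i w r.
Proof.
under eq_bigr do rewrite big_distrl /=.
under [RHS]eq_bigr do rewrite big_distrr /=.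
rewrite (exchange_big_dep predT) //= [RHS](exchange_big_dep predT) //=.
apply: eq_bigr => k _.
rewrite (reindex_onto (fun r => upd r k i) (fun r => upd r k j)) /=; last first.
  by move=> r /eqP <-; rewrite upd_upd upd_id.
have upd_eq r : (upd r k j == r) = (r k == j).
  by apply/eqP/eqP=> [<-|<-]; rewrite ?updE ?upd_id.
apply: eq_big => r; rewrite updE eqxx /= upd_upd upd_eq //.
by move=> /eqP <-; rewrite upd_id.
Qed.

(** The sl_2-relation [E_ji, E_ij] = E_jj - E_ii. Substitutions at distinct letters commute and
    cancel; what remains is a letter moved and moved back. *)
Lemma move_comm (i j : 'I_N) v r : i != j ->
  move j i (move i j v) r + (cnt r i)%:R * v r =
  move i j (move j i v) r + (cnt r j)%:R * v r.
Proof.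
move=> neq.
have expand a b : a != b -> move a b (move b a v) r =
    (cnt r a)%:R * v r + \sum_(k | r k == a) \sum_(l | r l == b)
      v (upd (upd r k b) l a).
  move=> neq_ab; rewrite cntE big_distrl -big_split /=.
  apply: eq_bigr => k /eqP rk; rewrite mul1r /move (bigD1 k) ?updE //=.
  have -> : upd (upd r k b) k a = r by rewrite upd_upd -rk upd_id.
  congr (_ + _); apply: eq_bigl => l.
  have [->|neq_lk] := eqVneq l k; first by rewrite rk andbF (negbTE neq_ab).
  by rewrite updN // andbT.
rewrite !expand // 1?eq_sym // [X in _ = _ + X + _]exchange_big /=.
rewrite addrAC [RHS]addrAC [X in X + _ = _]addrC; congr (_ + _).
apply: eq_bigr => k /eqP rk; apply: eq_bigr => l /eqP rl; rewrite updC //.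
by apply: contraNneq neq => E; rewrite -rk E rl.
Qed.

(* The sl_2-argument: a vector killed by a raising operator has dominant
   weight.  Here it is read off the norm of its image under the adjoint. *)
Lemma move_inj a (i j : 'I_N) v :
  i != j -> weight a v -> (a j < a i)%N -> (forall r, move j i v r = 0) ->
  forall r, v r = 0.
Proof.
move=> neq wt_v lt_a kill.
have EF r : move j i (move i j v) r = ((a j)%:R - (a i)%:R) * v r.
  have := move_comm v r neq; rewrite [X in _ = X + _]big1 ?add0r => [|k _]//.
  have [->|/wt_v wt_r] := eqVneq (v r) 0; first by rewrite !mulr0 addr0.
  by rewrite !wt_r mulrBl => /(canRL (addrK _)).
have : \sum_r `|move i j v r| ^+ 2 = ((a j)%:R - (a i)%:R) * \sum_r `|v r| ^+ 2.
  under eq_bigr do rewrite normCK.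
  have -> : \sum_r move i j v r * (move i j v r)^* =
            \sum_r v r * move j i (fun x => (move i j v x)^*) r.
    exact: move_adj.
  rewrite big_distrr; apply: eq_bigr => r _ /=; rewrite normCK.
  have -> : move j i (fun x => (move i j v x)^*) r = (move j i (move i j v) r)^*.
    by rewrite [RHS]rmorph_sum.
  by rewrite EF rmorphM rmorphB !rmorph_nat mulrCA.
move=> Esq; have le0 : 0 <= \sum_r `|move i j v r| ^+ 2.
  by apply: sumr_ge0 => r _; rewrite exprn_ge0.
have : \sum_r `|v r| ^+ 2 == 0.
  rewrite eq_le sumr_ge0 ?andbT => [|r _]; last by rewrite exprn_ge0.
  by move: le0; rewrite Esq nmulr_rge0 // subr_lt0 ltr_nat.
rewrite psumr_eq0 => [/allP z r|r _]; last by rewrite exprn_ge0.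
apply/normr0_eq0/eqP; rewrite -sqrf_eq0.
  exact: (implyP (z r (mem_index_enum r))).
Qed.

Lemma highest_lin a c v w :
  highest a v -> highest a w -> highest a (fun r => c * v r + w r).
Proof.
case=> wv Ev [ww Ew]; split=> [r|j i lt_ji r].
  have [->|/wv//] := eqVneq (v r) 0.
  by rewrite mulr0 add0r => /ww.
transitivity (c * move j i v r + move j i w r).
  by rewrite /move big_split big_distrr.
by rewrite Ev // Ew // mulr0 addr0.
Qed.

Lemma highest_ext a v w : v =1 w -> highest a v -> highest a w.
Proof.
move=> e [wv Ev]; split=> [r|j i lt_ji r]; first by rewrite -e => /wv.
by rewrite -(move_ext j i e) Ev.
Qed.

End Words.

(** * Components by the row of the last letter *)

Section LastLetter.
Variables (C : numClosedFieldType) (m N : nat).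
Implicit Types (r : {ffun 'I_m -> 'I_N}) (v : {ffun 'I_m.+1 -> 'I_N} -> C).

Definition ext r (i : 'I_N) : {ffun 'I_m.+1 -> 'I_N} :=
  [ffun k => if unlift ord_max k is Some k' then r k' else i].

Lemma ext_lift r i k : ext r i (lift ord_max k) = r k.
Proof. by rewrite ffunE liftK. Qed.

Lemma ext_max r i : ext r i ord_max = i.
Proof. by rewrite ffunE unlift_none. Qed.

Lemma ext_restrict (x : {ffun 'I_m.+1 -> 'I_N}) :
  x = ext [ffun k => x (lift ord_max k)] (x ord_max).
Proof.
by apply/ffunP=> k; rewrite ffunE; case: unliftP => [k'|] -> //; rewrite ffunE.
Qed.

Lemma upd_ext r i k j : upd (ext r i) (lift ord_max k) j = ext (upd r k j) i.
Proof.
apply/ffunP=> x; rewrite !ffunE; case: unliftP => [x'|] -> /=.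
  by rewrite ffunE (inj_eq lift_inj).
by rewrite (negbTE (neq_lift _ _)).
Qed.

Lemma upd_ext_max r i j : upd (ext r i) ord_max j = ext r j.
Proof.
apply/ffunP=> x; rewrite !ffunE; case: unliftP => [x'|] -> /=.
  by rewrite eq_sym (negbTE (neq_lift _ _)).
by rewrite eqxx.
Qed.

Lemma cnt_ext r (i : 'I_N) (a : nat) : cnt (ext r i) a = (cnt r a + (i == a :> nat))%N.
Proof.
rewrite /cnt -!sum1dep_card big_ord_lift ext_max /=; congr (_ + _)%N.
by apply: eq_bigl => k; rewrite ext_lift.
Qed.

Definition comp_at (i : 'I_N) v r : C := v (ext r i).

(** Either an earlier letter moves or the last one does. The second term ties two components
    together and is the source of all relations between them. *)
Lemma move_comp (j i a : 'I_N) v r :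
  move j i v (ext r a) =
  move j i (comp_at a v) r + (if a == j then comp_at i v r else 0).
Proof.
rewrite /move big_ord_lift ext_max upd_ext_max; congr (_ + _).
by apply: eq_big => k; rewrite ext_lift // upd_ext.
Qed.

(** Row indices grow downwards: the last letter is in row i or above, and component i is the lowest
    that may be nonzero. *)
Definition above (i : nat) v := forall j : 'I_N, (i < j)%N -> forall r, comp_at j v r = 0.

(** The last letter contributes to E_jk on component i only for j = i, and then through component k
    > i, which vanishes. *)
Lemma top_highest a (i : 'I_N) v :
  highest a v -> above i v -> highest (fun k => a k - (i == k :> nat))%N (comp_at i v).
Proof.
case=> wt_v kill ab; split=> [r /wt_v wt_r k|j k lt_jk r].
  by rewrite -wt_r cnt_ext addnK.
have := kill j k lt_jk (ext r i); rewrite move_comp.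
by case: eqP => [E|_]; rewrite ?addr0 // ab ?addr0 // E.
Qed.

(** Deleting a box from a row not longer than the next one leaves a weight that is not dominant,
    which [move_inj] excludes. *)
Lemma top_nonremovable a (i : 'I_N) v :
  highest a v -> above i v -> (forall k, N <= k -> a k = 0)%N ->
  (a i <= a i.+1)%N -> forall r, comp_at i v r = 0.
Proof.
(* The last row has none below it to raise from. There a i = 0, while a word ending in i has a
   letter in row i. *)
move=> hw ab a0 le_a r; have [E|lt_i] := eqVneq i.+1 N.
  have ai0 : a i = 0%N by apply/eqP; rewrite -leqn0 (leq_trans le_a) // E a0.
  apply/eqP/negPn/negP => /hw.1 /(_ i).
  by rewrite ai0 cnt_ext eqxx addn1.
have lt_iN : (i.+1 < N)%N by rewrite ltn_neqAle lt_i ltn_ord.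
pose i' := Ordinal lt_iN; have [/= wt_top kill_top] := top_highest hw ab.
apply/eqP/negPn/negP => nz; case/negP: (nz); apply/eqP.
have lt0 : (0 < a i)%N by have /hw.1/(_ i) := nz; rewrite cnt_ext eqxx addn1 => <-.
apply: (move_inj (i := i') (j := i) _ wt_top) => //; last exact: kill_top.
  by rewrite -val_eqE /= gtn_eqF.
by rewrite /= eqxx ltn_eqF // subn0 subn1 (leq_trans _ le_a) // ltn_predL.
Qed.

Definition jm v (x : {ffun 'I_m.+1 -> 'I_N}) : C :=
  \sum_(k < m) v [ffun l => x (tperm (lift ord_max k) ord_max l)].

(** Exchanging the last letter with a letter k of row j reads component j at the word where k has
    moved to row i. So X is the split Casimir operator, the sum over i, j of E_ij tensor E_ji. *)
Lemma jm_ext v r i : jm v (ext r i) = \sum_j move j i (comp_at j v) r.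
Proof.
rewrite /jm /move; under [RHS]eq_bigr do rewrite big_mkcond.
rewrite exchange_big; apply: eq_bigr => k _ /=.
rewrite -big_mkcond /= (big_pred1 (r k)) => [|j]; last by rewrite eq_sym.
congr (v _); apply/ffunP=> x; rewrite !ffunE.
case: (unliftP ord_max x) => [x'|] -> /=; last by rewrite tpermR liftK.
rewrite ffunE; have [->|neq] := eqVneq x' k; first by rewrite tpermL unlift_none.
by rewrite tpermD ?liftK ?neq_lift // (inj_eq lift_inj) eq_sym.
Qed.

(** Column minus row of the last box of row i; subtracting in C avoids truncation at an empty
    row. *)
Definition content (a : nat -> nat) (i : nat) : C := (a i)%:R - 1 - i%:R.

(* Each lowering operator E_ji with j < i sends the component in row j to
   minus the component in row i, whence the summand - i of the content. *)
Lemma jm_top a (i : 'I_N) v : highest a v -> above i v ->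
  forall r, comp_at i (jm v) r = content a i * comp_at i v r.
Proof.
move=> hw ab r; rewrite /comp_at jm_ext.
have [wt_v kill] := hw.
have term (j : 'I_N) : move j i (comp_at j v) r =
    (if j == i then (a i)%:R - 1 else - (j < i)%:R) * comp_at i v r.
  case: eqVneq => [->|neq]; last have [lt_ji|lt_ij] := ltnP j i.
  - transitivity ((cnt r i)%:R * comp_at i v r).
      rewrite cntE big_distrl; apply: eq_bigr => k /eqP <- /=.
      by rewrite upd_id mul1r.
    have [->|/wt_v/(_ i)] := eqVneq (comp_at i v r) 0; first by rewrite !mulr0.
    by rewrite cnt_ext eqxx addn1 => <-; rewrite -natr1 addrK.
  - have := kill j i lt_ji (ext r j); rewrite move_comp eqxx => /eqP.
    by rewrite addr_eq0 mulN1r => /eqP.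
  - rewrite oppr0 mul0r; apply: big1 => k _; apply: ab.
    by rewrite ltn_neqAle eq_sym neq.
under eq_bigr do rewrite term.
rewrite -big_distrl /=; congr (_ * _); rewrite (bigD1 i) //= eqxx /content.
congr (_ + _); rewrite (eq_bigr (fun j : 'I_N => - (j < i)%:R)) => [|j /negbTE->] //.
rewrite sumrN; congr (- _); rewrite -natr_sum; congr (_%:R).
transitivity (\sum_(j < N | (j < i)%N) 1)%N.
  rewrite [RHS]big_mkcond [RHS](bigD1 i) //= ltnn add0n.
  by apply: eq_bigr => j _; case: ltnP.
by rewrite -(big_ord_widen N (fun _ => 1%N) (ltnW (ltn_ord i))) sum1_card card_ord.
Qed.

(** X is triangular for the row of the last letter: for j < l the relation from E_jl turns component
    j into minus component l, which is zero; for j >= l component j itself is zero. *)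
Lemma jm_above a (i : 'I_N) v : highest a v -> above i v -> above i (jm v).
Proof.
move=> hw ab l lt_il r; rewrite /comp_at jm_ext; apply: big1 => j _.
have [lt_jl|le_lj] := ltnP j l; last first.
  by apply: big1 => k _; apply: ab; apply: leq_trans le_lj.
have := hw.2 j l lt_jl (ext r j); rewrite move_comp eqxx => /eqP.
by rewrite addr_eq0 ab // oppr0 => /eqP.
Qed.

End LastLetter.

(** * Specht modules as spaces of highest weight vectors *)

Lemma span_ind (K : fieldType) (V : vectType K) (X : seq V) (P : V -> Prop) :
  P 0 -> (forall c u w, P u -> P w -> P (c *: u + w)) ->
  (forall u, u \in X -> P u) -> forall u, u \in <<X>>%VS -> P u.
Proof.
move=> P0 Plin PX u /(coord_span (X := in_tuple X)) ->.
apply: (big_ind P) => // [x y Px Py|i _].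
  by rewrite -[x]scale1r; apply: Plin.
by rewrite -[X in P X]addr0; apply: Plin => //; apply/PX/mem_nth.
Qed.

Section Shape.
Variables (n : nat) (la : intpart n).

Lemma sum_rowlen : (\sum_(i < n) rowlen la i = n)%N.
Proof.
have /andP[_ /eqP e] := svalP la; rewrite -[RHS]e.
by apply: eq_bigr => i _; rewrite row_ord.
Qed.

Lemma rowlen_out i : (n <= i)%N -> rowlen la i = 0%N.
Proof. by move=> le_ni; rewrite /rowlen insubF // ltnNge le_ni. Qed.

Lemma card_diag_row (i : 'I_n) :
  #|[set b in diag n la | b.1 == i]| = rowlen la i.
Proof.
have -> : [set b in diag n la | b.1 == i]
        = setX [set i] [set j : 'I_n | (j < rowlen la i)%N].
  by apply/setP=> -[i' j]; rewrite !inE andbC; case: eqP => //= ->.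
by rewrite cardsX cards1 mul1n card_ltn // row_le.
Qed.

Lemma card_diag : #|diag n la| = n.
Proof.
rewrite -[RHS]sum_rowlen -sum1_card (partition_big fst predT) //=.
apply: eq_bigr => i _; rewrite -card_diag_row -sum1_card.
by apply: eq_bigl => b; rewrite !inE.
Qed.

Variable t : {ffun 'I_n -> 'I_n * 'I_n}.
Hypothesis Tt : tableau la t.

Lemma tableau_inj : injective t.
Proof. by case/andP: Tt => /injectiveP. Qed.

Lemma tableau_diag k : t k \in diag n la.
Proof. by case/andP: Tt => _ /forallP. Qed.

Lemma tableau_codom : t @: [set: 'I_n] = diag n la.
Proof.
apply/eqP; rewrite eqEcard card_diag card_imset ?cardsT ?card_ord ?leqnn ?andbT //.
  by apply/subsetP=> _ /imsetP[k _ ->]; apply: tableau_diag.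
exact: tableau_inj.
Qed.

Lemma tableau_surj b : b \in diag n la -> exists k, t k = b.
Proof. by rewrite -tableau_codom => /imsetP[k _ ->]; exists k. Qed.

Lemma cnt_tabloid (i : 'I_n) : cnt (tabloid t) i = rowlen la i.
Proof.
rewrite -card_diag_row -tableau_codom /cnt -(card_imset _ tableau_inj).
apply: eq_card => b; apply/imsetP/setIdP => [[k] + ->|[/imsetP[k _ ->] e]].
  by rewrite inE ffunE => e; split; [apply: imset_f; rewrite inE|].
by exists k; rewrite // inE ffunE.
Qed.

End Shape.

Lemma cnt_perm n N (r : {ffun 'I_n -> 'I_N}) (s : 'S_n) i :
  cnt [ffun k => r (s k)] i = cnt r i.
Proof.
rewrite /cnt -(card_imset _ (@perm_inj _ s)); apply: eq_card => k.
apply/imsetP/idP => [[l + ->]|]; rewrite !inE ?ffunE // => e.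
by exists (s^-1 k)%g; rewrite ?inE ?ffunE permKV.
Qed.

Section Polytabloids.
Variables (C : numClosedFieldType) (n : nat).
Implicit Types (t : {ffun 'I_n -> 'I_n * 'I_n}) (r : {ffun 'I_n -> 'I_n}).

Lemma polytabloidE t r :
  polytabloid C t r =
  \sum_(s in colstab t) (-1) ^+ s * ([ffun k => r (s k)] == tabloid t)%:R.
Proof. by rewrite sum_ffunE; apply: eq_bigr => s _; rewrite !ffunE. Qed.

(** The transposition (x y) is in the column stabilizer and fixes z, so reindexing by it turns the
    sum into its own negative. *)
Lemma alternating0 t r (z : {ffun 'I_n -> 'I_n}) (x y : 'I_n) :
  x != y -> (t x).2 = (t y).2 ->
  [ffun k => z (tperm x y k)] = z ->
  \sum_(s in colstab t) (-1) ^+ s * ([ffun k => r (s k)] == z)%:R = 0 :> C.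
Proof.
move=> neq col_xy zinv; apply/eqP.
set S := (X in X == 0); suff : S + S == 0.
  by rewrite -mulr2n mulrn_eq0.
rewrite {1}/S (reindex_inj (mulgI (tperm x y))) /= addr_eq0 -sumrN; apply/eqP.
have col k : (t (tperm x y k)).2 = (t k).2 by case: tpermP => // ->.
apply: eq_big => s.
  rewrite !inE; apply/forallP/forallP=> h k; last by rewrite permM -(col k) h.
  by have := h (tperm x y k); rewrite permM tpermK col.
move=> _; rewrite odd_permM odd_tperm neq signr_addb mulNr mul1r mulNr.
congr (- (_ * _%:R)); congr nat_of_bool; apply/eqP/eqP => e.
  by rewrite -zinv -e; apply/ffunP=> k; rewrite !ffunE permM tpermK.
by rewrite -zinv -e; apply/ffunP=> k; rewrite !ffunE permM.
Qed.

(** Raising a letter x from row i to row j puts it in one row with the letter y that stands in row j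
    of the column of x, and column antisymmetrization kills such a tabloid. *)
Lemma polytabloid_highest la t :
  tableau la t -> highest (rowlen la) (polytabloid C t).
Proof.
move=> Tt; split=> [r|j i lt_ji r].
  rewrite polytabloidE => nz i.
  have [s /eqP e|none] := pickP (fun s : 'S_n => [ffun k => r (s k)] == tabloid t).
    by rewrite -(cnt_perm r s) e (cnt_tabloid Tt).
  by move: nz; rewrite big1 ?eqxx // => s _; rewrite none mulr0.
(* The move passes from the word to the tabloid: a letter contributes only if it is in row j of the
   permuted word and in row i of the tabloid. *)
have -> : move j i (polytabloid C t) r = \sum_(x | (t x).1 == i)
    \sum_(s in colstab t) (-1) ^+ s *
       ([ffun k => r (s k)] == upd (tabloid t) x j)%:R.
  rewrite /move; under eq_bigr do rewrite polytabloidE.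
  rewrite exchange_big [RHS]exchange_big; apply: eq_bigr => s _ /=.
  rewrite (reindex_inj (@perm_inj _ s)) /= big_mkcond [RHS]big_mkcond.
  apply: eq_bigr => x _.
  have -> : ([ffun k => upd r (s x) i (s k)] == tabloid t) =
    (upd [ffun k => r (s k)] x i == tabloid t).
    by congr (_ == _); apply/ffunP=> k; rewrite !ffunE (inj_eq perm_inj).
  set w := [ffun k => r (s k)].
  have -> : r (s x) = w x by rewrite ffunE.
  have -> : (t x).1 = tabloid t x by rewrite ffunE.
  case: (w x =P j) => [<-|neq]; case: (tabloid t x =P i) => [e|neq'] //.
  - congr (_ * _%:R); congr nat_of_bool; apply/eqP/eqP => [<-|->].
      by rewrite upd_upd upd_id.
    by rewrite upd_upd -e upd_id.
  - by case: eqP neq' => [<-|_]; rewrite ?updE // mulr0.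
  - by case: eqP neq => [->|_]; rewrite ?updE // mulr0.
apply: big1 => x /eqP tx.
have [|y ty] := tableau_surj Tt (b := (j, (t x).2)).
  have := tableau_diag Tt x; rewrite !inE /= tx => /leq_trans; apply.
  exact/row_decr/ltnW.
have neq : x != y.
  by apply: contraTneq lt_ji => E; rewrite -tx E ty ltnn.
apply: (alternating0 _ neq); first by rewrite ty.
apply/ffunP=> k; rewrite !ffunE; case: tpermP => [->|->|_ _] //.
  by rewrite eqxx eq_sym (negbTE neq) ty.
by rewrite eqxx eq_sym (negbTE neq) ty.
Qed.

Lemma specht_highest (la : intpart n) v :
  v \in specht_space C la -> highest (rowlen la) v.
Proof.
move: v; apply: span_ind => [|c u w hu hw|u].
- split=> [r|j i _ r]; first by rewrite ffunE eqxx.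
  by apply: big1 => k _; rewrite ffunE.
- by apply: (highest_ext _ (highest_lin c hu hw)) => r; rewrite !ffunE.
- by case/mapP=> t + ->; rewrite mem_enum; apply: polytabloid_highest.
Qed.

End Polytabloids.

(** * Removable boxes, residues and contents *)

Lemma rowlen_inj n (la nu : intpart n) : rowlen la =1 rowlen nu -> la = nu.
Proof.
move=> e; apply/val_inj/ffunP=> i; apply/val_inj.
by have := e i; rewrite !row_ord.
Qed.

Section RemovedBox.
Variable m : nat.
Implicit Types (mu : intpart m) (la : intpart m.+1) (i : 'I_m.+1).

(** The row form of [removed]: mu is the weight that [top_highest] gives to component i. *)
Definition remrow mu la i :=
  (0 < rowlen la i)%N /\ forall k, rowlen mu k = (rowlen la k - (i == k :> nat))%N.

Lemma remrow_inj mu la i j : remrow mu la i -> remrow mu la j -> i = j.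
Proof.
move=> [pos_i ri] [_ rj]; apply/val_inj/eqP.
have := ri i; rewrite rj eqxx eq_sym => e; case: eqP e => //= _; lia.
Qed.

Lemma remrow_fun mu nu la i : remrow mu la i -> remrow nu la i -> mu = nu.
Proof. by move=> [_ rmu] [_ rnu]; apply: rowlen_inj => k; rewrite rmu rnu. Qed.

Lemma remrow_lt mu la i (j : nat) : remrow mu la i -> (i < j)%N ->
  (rowlen la j < rowlen la i)%N.
Proof.
move=> [pos r] lt_ij; have := row_decr mu (ltnW lt_ij).
by rewrite !r eqxx (ltn_eqF lt_ij); lia.
Qed.

Lemma remrow_exists la i :
  (rowlen la i.+1 < rowlen la i)%N -> exists mu, remrow mu la i.
Proof.
move=> lt_i; pose a k := (rowlen la k - (i == k :> nat))%N.
have decr k l : (k <= l)%N -> (a l <= a k)%N.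
  rewrite /a => le_kl; have := row_decr la le_kl.
  case: (eqVneq (i : nat) k) => [Ek|_]; last by lia.
  case: (ltnP i l) => [lt_il|le_li]; first
    by have := row_decr la lt_il; rewrite Ek in lt_i *; lia.
  by have -> : l = k; [lia | rewrite Ek eqxx].
have sum_a : (\sum_(k < m.+1) a k = m)%N.
  apply/eqP; rewrite -eqSS -[in X in _ == X](sum_rowlen la) (bigD1 i) //=.
  rewrite [X in _ == X](bigD1 i) //= -addSn; apply/eqP; congr (_ + _)%N.
    by rewrite /a eqxx; lia.
  apply: eq_bigr => k; rewrite -val_eqE /= => neq.
  by rewrite /a eq_sym (negbTE neq) subn0.
(* The last row must be empty: m + 1 nonempty rows would need more than m boxes. *)
have am0 : a m = 0%N.
  apply/eqP/negPn/negP => nz.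
  have : (\sum_(k < m.+1) 1 <= \sum_(k < m.+1) a k)%N.
    apply: leq_sum => k _; apply: leq_trans (decr k m _); last by rewrite -ltnS.
    by rewrite lt0n.
  by rewrite sum_a sum1_card card_ord ltnn.
have le_a (k : nat) : (k < m)%N -> (a k < m.+1)%N.
  move=> lt_k; rewrite ltnS -[X in (_ <= X)%N]sum_a.
  by rewrite (bigD1 (Ordinal (ltnW lt_k : (k < m.+1)%N))) //= leq_addr.
have P : is_intpart [ffun k : 'I_m => inord (a k) : 'I_m.+1].
  apply/andP; split.
    apply/forallP=> k; apply/forallP=> l; apply/implyP=> le_kl.
    by rewrite !ffunE !inordK ?le_a // decr.
  apply/eqP; rewrite -[RHS]sum_a big_ord_recr /= am0 addn0.
  by apply: eq_bigr => k _; rewrite ffunE inordK ?le_a.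
exists (exist (@is_intpart m) _ P); split=> [|k]; first by lia.
rewrite -/(a k) {1}/rowlen; case: insubP => [k' lt_k <-|].
  by rewrite /= ffunE inordK // le_a.
rewrite -leqNgt => /decr; rewrite am0; lia.
Qed.

Lemma removed_remrow mu la b : removed mu la b ->
  remrow mu la b.1 /\ b.2 = (rowlen la b.1).-1 :> nat.
Proof.
case: b => i j /andP[b_la /eqP e] /=.
have lt_j : (j < rowlen la i)%N by move: b_la; rewrite inE.
have row_e (k l : 'I_m.+1) :
    (l < rowlen mu k)%N = ((k, l) != (i, j)) && (l < rowlen la k)%N.
  by have /setP/(_ (k, l)) := e; rewrite !inE.
have row_k k : rowlen mu k = (rowlen la k - (i == k :> nat))%N.
  case: (ltnP k m.+1) => [lt_k|le_k]; last first.
    by rewrite !rowlen_out ?sub0n // ltnW.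
  pose k' := Ordinal lt_k; rewrite -[k]/(k' : nat).
  rewrite -(card_ltn (leqW (row_le mu k'))).
  rewrite -[in RHS](card_ltn (row_le la k')).
  case: (eqVneq (i : nat) k') => [/val_inj Ei|neq]; last first.
    rewrite subn0; apply: eq_card => l; rewrite !inE row_e xpair_eqE.
    by have -> : (k' == i) = false by apply/negbTE; rewrite eq_sym.
  rewrite [in RHS](cardsD1 j) inE -Ei lt_j addKn; apply: eq_card => l.
  by rewrite !inE row_e xpair_eqE eqxx.
split; first by split; [lia|].
(* The last box of row i lies in la and not in mu, so [row_e] forces it to be (i, j). *)
have lt_r : ((rowlen la i).-1 < m.+1)%N by have := row_le la i; lia.
have := row_e i (Ordinal lt_r); rewrite row_k eqxx xpair_eqE eqxx /=.
have -> : ((rowlen la i).-1 < rowlen la i - true)%N = false by lia.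
have -> : ((rowlen la i).-1 < rowlen la i)%N by lia.
by rewrite andbT => /esym/negbFE/eqP <-.
Qed.

Lemma remrow_prec mu la i : remrow mu la i -> prec mu la.
Proof.
case=> pos r; have lt_r : ((rowlen la i).-1 < m.+1)%N by have := row_le la i; lia.
apply/existsP; exists (i, Ordinal lt_r); apply/andP; split.
  by rewrite inE /=; lia.
apply/eqP/setP=> -[k l]; rewrite !inE /= r xpair_eqE -!val_eqE /=.
by case: eqVneq => [<-|_] /=; have := pos; lia.
Qed.

Lemma prec_remrow mu la : prec mu la -> exists i, remrow mu la i.
Proof. by case/existsP=> b /removed_remrow[]; exists b.1. Qed.

Lemma residueE mu la i : remrow mu la i ->
  residue la mu = (rowlen la i)%:Z - 1 - i%:Z.
Proof.
move=> ri; rewrite /residue; case: pickP => [b /removed_remrow[rb ->]|none].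
  by rewrite (remrow_inj rb ri); have := ri.1; lia.
by have /existsP[b] := remrow_prec ri; rewrite none.
Qed.

Lemma content_residue (C : numClosedFieldType) mu la i : remrow mu la i ->
  content C (rowlen la) i = (residue la mu)%:~R.
Proof. by move=> /residueE->; rewrite !rmorphB /=. Qed.

End RemovedBox.

(** Row lengths weakly decrease while the row index grows, so contents strictly decrease along all
    rows, removable or not. *)
Lemma content_inj (C : numClosedFieldType) n (la : intpart n) (i j : nat) :
  content C (rowlen la) i = content C (rowlen la) j -> i = j.
Proof.
have contentE k : content C (rowlen la) k = ((rowlen la k)%:Z - 1 - k%:Z)%:~R.
  by rewrite !rmorphB.
rewrite !contentE => /intr_inj; have := @row_decr n la i j; have := @row_decr n la j i.
lia.
Qed.

Lemma emb_surj m (s : 'S_m.+1) : s ord_max = ord_max -> exists t, s = emb t.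
Proof.
move=> s_max; pose f k := odflt k (unlift ord_max (s (lift ord_max k))).
have fE k : lift ord_max (f k) = s (lift ord_max k).
  rewrite /f; case: unliftP => [k' -> //|]; rewrite -{2}s_max => /perm_inj /eqP.
  by rewrite eq_sym (negbTE (neq_lift _ _)).
have f_inj : injective f.
  by move=> k l /(congr1 (lift ord_max)); rewrite !fE => /perm_inj/lift_inj.
exists (perm f_inj); apply/permP=> k; rewrite /emb.
case: (unliftP ord_max k) => [k'|] ->; last by rewrite lift_perm_id.
by rewrite lift_perm_lift permE fE.
Qed.

Lemma emb_inj m : injective (@emb m).
Proof.
move=> s t e; apply/permP=> k; apply/(@lift_inj _ ord_max).
by rewrite -!(lift_perm_lift ord_max ord_max) -!/(emb _) e.
Qed.

(** * Restricting components and lifting polytabloids *)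

Section RestrictedWords.
Variables (C : numClosedFieldType) (m : nat).
Implicit Types (mu : intpart m) (la : intpart m.+1) (i : 'I_m.+1).
Implicit Types (v : ambient C m.+1) (r : {ffun 'I_m -> 'I_m}).

Definition widen_word r : {ffun 'I_m -> 'I_m.+1} :=
  [ffun k => widen_ord (leqnSn m) (r k)].

(** The ambient space of n - 1 letters has one row fewer, so a component is cut down to words
    avoiding the last row; [rest_eq0] shows that nothing is lost. *)
Definition rest i v : ambient C m := [ffun r => v (ext (widen_word r) i)].

Lemma rest_lin i : linear (rest i).
Proof. by move=> c u v; apply/ffunP=> r; rewrite !ffunE. Qed.
HB.instance Definition _ i :=
  GRing.isLinear.Build C (ambient C m.+1) (ambient C m) _ (rest i) (rest_lin i).

Lemma rest_emb i (s : 'S_m) v :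
  rest i (perm_act (emb s) v) = perm_act s (rest i v).
Proof.
apply/ffunP=> r; rewrite !ffunE; congr (v _); apply/ffunP=> k.
rewrite !ffunE /emb; case: (unliftP ord_max k) => [k'|] ->.
  by rewrite lift_perm_lift !liftK !ffunE.
by rewrite lift_perm_id unlift_none.
Qed.

Lemma cnt_widen r k : cnt (widen_word r) k = cnt r k.
Proof. by apply: eq_card => l; rewrite !inE ffunE. Qed.

Lemma upd_widen r k (i : 'I_m) :
  upd (widen_word r) k (widen_ord (leqnSn m) i) = widen_word (upd r k i).
Proof. by apply/ffunP=> l; rewrite !ffunE; case: eqP. Qed.

Lemma rest_highest mu la i v :
  highest (rowlen la) v -> above i v -> remrow mu la i ->
  highest (rowlen mu) (rest i v).
Proof.
move=> hw ab [_ rmu]; have [wt kill] := top_highest hw ab.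
split=> [r|j k lt_jk r].
  by rewrite ffunE => /wt wt_r k; rewrite -cnt_widen rmu -(wt_r (widen_ord _ k)).
rewrite -[RHS](kill (widen_ord (leqnSn m) j) (widen_ord (leqnSn m) k) lt_jk
  (widen_word r)).
apply: eq_big => l; first by rewrite ffunE -!val_eqE.
by rewrite ffunE upd_widen.
Qed.

(** A word using row m has the wrong weight, since mu only has rows 0 to m - 1. *)
Lemma rest_eq0 mu la i v :
  weight (rowlen la) v -> remrow mu la i -> rest i v = 0 ->
  forall r : {ffun 'I_m -> 'I_m.+1}, comp_at i v r = 0.
Proof.
move=> wt ri v0 r; apply/eqP/negPn/negP => nz.
have lt_r k : (r k < m)%N.
  have := wt _ nz ord_max; rewrite cnt_ext => e.
  have : cnt r m = 0%N by have := ri.2 m; rewrite rowlen_out //; move: e => /=; lia.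
  move/eqP; rewrite cards_eq0 => /eqP/setP/(_ k); rewrite !inE => /negbT.
  by have := ltn_ord (r k); lia.
pose r' : {ffun 'I_m -> 'I_m} := [ffun k => Ordinal (lt_r k)].
have Er : r = widen_word r' by apply/ffunP=> k; apply/val_inj; rewrite !ffunE.
by case/negP: nz; move/ffunP: v0 => /(_ r'); rewrite !ffunE /comp_at Er => ->.
Qed.

Definition add_box la i (t : {ffun 'I_m -> 'I_m * 'I_m}) :
    {ffun 'I_m.+1 -> 'I_m.+1 * 'I_m.+1} :=
  [ffun k => if unlift ord_max k is Some k'
             then (widen_ord (leqnSn m) (t k').1, widen_ord (leqnSn m) (t k').2)
             else (i, inord (rowlen la i).-1)].

Section AddBox.
Variables (mu : intpart m) (la : intpart m.+1) (i : 'I_m.+1).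
Variable t : {ffun 'I_m -> 'I_m * 'I_m}.
Hypotheses (ri : remrow mu la i) (Tt : tableau mu t).
Let t' := add_box la i t.

Let t'_lift k : t' (lift ord_max k) =
  (widen_ord (leqnSn m) (t k).1, widen_ord (leqnSn m) (t k).2).
Proof. by rewrite ffunE liftK. Qed.

Let t'_max : t' ord_max = (i, inord (rowlen la i).-1).
Proof. by rewrite ffunE unlift_none. Qed.

Let new_col : (inord (rowlen la i).-1 : 'I_m.+1) = (rowlen la i).-1 :> nat.
Proof. by rewrite inordK //; have := row_le la i; have := ri.1; lia. Qed.

Let old_box k : ((t k).2 < rowlen la (t k).1 - (i == (t k).1 :> nat))%N.
Proof. by have := tableau_diag Tt k; rewrite inE ri.2. Qed.

Lemma tableau_add_box : tableau la t'.
Proof.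
apply/andP; split; last first.
  apply/forallP=> k; case: (unliftP ord_max k) => [k'|] ->; rewrite inE.
    by rewrite t'_lift /=; have := old_box k'; lia.
  by rewrite t'_max /= new_col; have := ri.1; lia.
have neq k : t' (lift ord_max k) <> t' ord_max.
  rewrite t'_lift t'_max => -[e1 /(congr1 val)]; rewrite /= new_col => e2.
  by have := old_box k; rewrite e2 -e1 /= eqxx; lia.
apply/injectiveP=> k l; case: (unliftP ord_max k) => [k'|] ->;
  case: (unliftP ord_max l) => [l'|] -> //; last 2 first.
- by move/neq.
- by move/esym/neq.
rewrite !t'_lift => -[e1 e2]; congr (lift _ _); apply: (tableau_inj Tt).
by case: (t k') (t l') e1 e2 => [a b] [c d] /= e1 e2; congr pair; apply/val_inj.
Qed.

(* A word occurring in the polytabloid has its last letter in a box of the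
   column of the new box, hence in row i or above. *)
Lemma add_box_last (s : 'S_m.+1) x : s \in colstab t' ->
  [ffun k => x (s k)] = tabloid t' ->
  (x ord_max <= i)%N /\ (x ord_max = i -> s ord_max = ord_max).
Proof.
rewrite inE => /forallP col /ffunP e; pose k := (s^-1 ord_max)%g.
have col_k : (t' k).2 = (rowlen la i).-1 :> nat.
  by have /eqP := col k; rewrite permKV t'_max => <-; rewrite new_col.
have row_k : (t' k).1 = x ord_max by have := e k; rewrite !ffunE permKV.
have in_k := tableau_diag tableau_add_box k; split.
  (* Rows below i are strictly shorter than row i and do not reach the column of the new box. *)
  rewrite leqNgt; apply/negP => /(remrow_lt ri).
  by move: in_k; rewrite inE col_k row_k; lia.
move=> xi; suff Ek : ord_max = k by rewrite {1}Ek permKV.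
apply: (tableau_inj tableau_add_box); rewrite t'_max.
case: (t' k) col_k row_k => a b /= col_k ->; congr pair; rewrite ?xi //.
by apply/val_inj; rewrite /= new_col.
Qed.

Lemma above_add_box : above i (polytabloid C t').
Proof.
move=> j lt_ij r; rewrite /comp_at polytabloidE big1 // => s sC.
case: eqP => [/(add_box_last sC)[]|_]; last by rewrite mulr0.
by rewrite ext_max leqNgt lt_ij.
Qed.

(** By [add_box_last] only column permutations fixing the last letter contribute, and these are the
    column permutations of t with the same signs. *)
Lemma rest_add_box : rest i (polytabloid C t') = polytabloid C t.
Proof.
apply/ffunP=> r; rewrite ffunE !polytabloidE; set x := ext _ _.
have embC s : (emb s \in colstab t') = (s \in colstab t).
  rewrite !inE; apply/forallP/forallP=> h k.
    have := h (lift ord_max k); rewrite /emb lift_perm_lift !t'_lift /=.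
    by rewrite -!val_eqE.
  case: (unliftP ord_max k) => [k'|] ->; rewrite /emb.
    by rewrite lift_perm_lift !t'_lift /=; have := h k'; rewrite -!val_eqE.
  by rewrite lift_perm_id.
have embE s : ([ffun k => x (emb s k)] == tabloid t')
            = ([ffun k => r (s k)] == tabloid t).
  apply/eqP/eqP => /ffunP e; apply/ffunP=> k.
    have := e (lift ord_max k); rewrite /emb ffunE lift_perm_lift ext_lift.
    by rewrite !ffunE liftK => /(congr1 val) /= e'; apply/val_inj.
  rewrite ffunE [RHS]ffunE /emb; case: (unliftP ord_max k) => [k'|] ->.
    rewrite lift_perm_lift ext_lift t'_lift ffunE; apply/val_inj.
    by have := e k'; rewrite !ffunE => ->.
  by rewrite lift_perm_id t'_max ext_max.
rewrite (bigID (mem (@emb m @: colstab t))) /= [X in _ + X]big1 ?addr0.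
  rewrite (eq_bigl (mem (@emb m @: colstab t))) => [|s].
    rewrite big_imset => [|s s' _ _ /emb_inj //].
    by apply: eq_bigr => s _; rewrite embE odd_lift_perm addbb.
  by rewrite andb_idl // => /imsetP[s' s'C ->]; rewrite embC.
move=> s /andP[sC nim]; case: eqP => [e|_]; last by rewrite mulr0.
have /emb_surj[s' Es] := (add_box_last sC e).2 (ext_max _ _).
by case/imsetP: nim; exists s'; rewrite // -embC -Es.
Qed.

End AddBox.

Lemma specht_lift mu la i w : remrow mu la i -> w \in specht_space C mu ->
  exists u, [/\ u \in specht_space C la, above i u & rest i u = w].
Proof.
move=> ri; move: w; apply: span_ind => [|c w1 w2|w].
- exists 0; split; rewrite ?mem0v ?linear0 // => j _ r.
  by rewrite /comp_at ffunE.
- move=> [u1 [S1 a1 <-]] [u2 [S2 a2 <-]]; exists (c *: u1 + u2).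
  split; rewrite ?linearP ?memvD ?memvZ // => j lt_ij r.
  have := a1 j lt_ij r; have := a2 j lt_ij r; rewrite /comp_at !ffunE => -> ->.
  by rewrite scaler0 addr0.
case/mapP=> t; rewrite mem_enum => Tt ->; exists (polytabloid C (add_box la i t)).
split; [|exact: above_add_box ri Tt|exact: rest_add_box ri Tt].
by apply/memv_span/map_f; rewrite mem_enum; apply: tableau_add_box ri Tt.
Qed.

End RestrictedWords.

Lemma highest_specht0 (C : numClosedFieldType) (la : intpart 0) (v : ambient C 0) :
  v \in specht_space C la.
Proof.
have noI (T : Type) (k : 'I_0) : T by case: k.
pose t : {ffun 'I_0 -> 'I_0 * 'I_0} := [ffun k => (k, k)].
have Tt : tableau la t.
  by apply/andP; split; [apply/injectiveP=> k|apply/forallP=> k]; apply: noI k.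
have r_eq (r r' : {ffun 'I_0 -> 'I_0}) : r = r' by apply/ffunP=> k; apply: noI k.
suff -> : v = v (tabloid t) *: polytabloid C t.
  by apply/memvZ/memv_span/map_f; rewrite mem_enum.
apply/ffunP=> r; rewrite ffunE polytabloidE (r_eq r (tabloid t)) (big_pred1 1%g).
  rewrite odd_perm1 mul1r (_ : (_ == _) = true); last exact/eqP/r_eq.
  by rewrite [_ *: _]mulr1.
move=> s; have -> : s = 1%g by apply/permP=> k; apply: noI k.
by rewrite /= eqxx inE; apply/forallP=> k; apply: noI k.
Qed.

(* James' kernel intersection theorem, proved together with the branching
   rule: subtracting a lift of its lowest nonzero component moves a highest
   vector one step up the filtration by the row of the last letter. *)
Theorem specht_kernel (C : numClosedFieldType) n (la : intpart n) (v : ambient C n) :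
  reflect (highest (rowlen la) v) (v \in specht_space C la).
Proof.
apply: (iffP idP) => [|hw]; first exact: specht_highest.
elim: n => [|m IHm] in la v hw *; first exact: highest_specht0.
(* Induction on how far down the last letter may go; at i = m + 1 the condition is empty. *)
have main i : (i <= m.+1)%N -> forall u : ambient C m.+1, highest (rowlen la) u ->
    (forall j : 'I_m.+1, (i <= j)%N -> forall r, comp_at j u r = 0) ->
    u \in specht_space C la.
  elim: i => [_ u _ u0|i IHi lt_i u hw_u ab].
    suff -> : u = 0 by rewrite mem0v.
    by apply/ffunP=> x; rewrite ffunE (ext_restrict x) -/(comp_at _ u _) u0.
  pose i' := Ordinal lt_i; have ab' : above i' u by [].
  have step (w : ambient C m.+1) : highest (rowlen la) w ->
      above i' w -> (forall r, comp_at i' w r = 0) ->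
      w \in specht_space C la.
    move=> hw_w ab_w w0; apply: IHi => //; first exact: ltnW.
    move=> j; rewrite leq_eqVlt => /orP[/eqP Ej|]; last exact: ab_w.
    by have -> : j = i' by apply/val_inj.
  have [lt_row|le_row] := ltnP (rowlen la i.+1) (rowlen la i); last first.
    (* A row without removable box carries no component, so there is nothing to subtract. *)
    apply: step => //; apply: (top_nonremovable hw_u ab') => // k.
    exact: rowlen_out.
  have [mu ri] := @remrow_exists _ la i' lt_row.
  have Smu : rest i' u \in specht_space C mu.
    by apply/IHm; apply: rest_highest hw_u ab' ri.
  have [w [Sw ab_w Ew]] := specht_lift ri Smu.
  rewrite -(subrK w u) memvD //; apply: step.
  - apply: (highest_ext _ (highest_lin (-1) (specht_highest Sw) hw_u)) => r.
    by rewrite !ffunE mulN1r addrC.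
  - move=> j lt_ij r; have := ab' j lt_ij r; have := ab_w j lt_ij r.
    by rewrite /comp_at !ffunE => -> ->; rewrite subr0.
  apply: (rest_eq0 _ ri); last by rewrite linearB /= Ew subrr.
  move=> r; rewrite !ffunE => nz.
  have [u0|/hw_u.1//] := eqVneq (u r) 0.
  by apply: (specht_highest Sw).1; apply: contraNneq nz => ->; rewrite u0 subrr.
by apply: (main m.+1) => // j; rewrite leqNgt ltn_ord.
Qed.

(** * Jucys-Murphy elements and the branching rule *)

Section JucysMurphy.
Variables (C : numClosedFieldType) (m : nat).

HB.instance Definition _ n (V : snmod C n) s :=
  GRing.isLinear.Build C V V _ (@mact C n V s) (mact_lin s).

Definition murphy (V : snmod C m.+1) (u : V) : V :=
  \sum_(k < m) mact (tperm (lift ord_max k) ord_max) u.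

Lemma murphy_lin V : linear (@murphy V).
Proof.
move=> c u w; rewrite scaler_sumr -big_split.
by apply: eq_bigr => k _; rewrite linearP.
Qed.
HB.instance Definition _ (V : snmod C m.+1) :=
  GRing.isLinear.Build C V V _ (@murphy V) (@murphy_lin V).

(** Conjugation by S_(n-1) permutes the transpositions (k n). *)
Lemma murphy_emb (V : snmod C m.+1) (s : 'S_m) (u : V) :
  murphy (mact (emb s) u) = mact (emb s) (murphy u).
Proof.
rewrite linear_sum [RHS](reindex_inj (@perm_inj _ s^-1)).
apply: eq_bigr => k _; rewrite /= -!mactM; congr (mact _ u).
have -> : tperm (lift ord_max (s^-1 k)%g) ord_max
        = (tperm (lift ord_max k) ord_max ^ (emb s)^-1)%g.
  by rewrite tpermJ /emb lift_permV lift_perm_lift lift_perm_id.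
by rewrite conjgE invgK !mulgA mulgKV.
Qed.

Definition murphy_shift (V : snmod C m.+1) (e d : C) (u : V) : V :=
  e *: (murphy u - d *: u).

Lemma murphy_shift_lin (V : snmod C m.+1) e d : linear (@murphy_shift V e d).
Proof.
move=> a u w; rewrite /murphy_shift linearP /= [d *: (_ + _)]scalerDr opprD addrACA.
rewrite scalerDr; congr (_ + _); rewrite [d *: (a *: _)]scalerA [d * a]mulrC.
by rewrite -[(a * d) *: _]scalerA -scalerBr !scalerA mulrC.
Qed.
HB.instance Definition _ (V : snmod C m.+1) e d :=
  GRing.isLinear.Build C V V _ (@murphy_shift V e d) (@murphy_shift_lin V e d).

Lemma murphy_shiftC (V : snmod C m.+1) e d (u : V) :
  murphy_shift e d (murphy u) = murphy (murphy_shift e d u).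
Proof. by rewrite [RHS]linearZ linearB linearZ. Qed.

Lemma murphy_shift_emb (V : snmod C m.+1) e d (s : 'S_m) (u : V) :
  murphy_shift e d (mact (emb s) u) = mact (emb s) (murphy_shift e d u).
Proof.
rewrite /murphy_shift murphy_emb [RHS]linearZ; congr (_ *: _).
by rewrite [RHS]linearB; congr (_ - _); rewrite linearZ.
Qed.

Lemma murphy_shift_eig (V : snmod C m.+1) e d c (u : V) :
  murphy u = c *: u -> murphy_shift e d u = (e * (c - d)) *: u.
Proof. by move=> eig; rewrite /murphy_shift eig -scalerBl scalerA. Qed.

End JucysMurphy.

Section Branching.
Variables (C : numClosedFieldType) (m : nat) (la : intpart m.+1).
Local Notation S := (specht C la).
Local Notation ct := (content C (rowlen la)).
Implicit Types (u y : S) (i j : 'I_m.+1).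

Lemma amb_inj n (nu : intpart n) : injective (@amb C n nu).
Proof. exact: val_inj. Qed.

Lemma amb_highest n (nu : intpart n) (u : specht C nu) :
  highest (rowlen nu) (amb u).
Proof. exact/specht_kernel/subvsP. Qed.

Lemma amb_murphy u : amb (murphy u) =1 jm (amb u).
Proof.
by move=> x; rewrite /amb linear_sum sum_ffunE; apply: eq_bigr => k _; rewrite ffunE.
Qed.

Lemma murphy_top i u : above i (amb u) ->
  forall r, comp_at i (amb (murphy u)) r = ct i * comp_at i (amb u) r.
Proof.
move=> ab r; rewrite -(jm_top (amb_highest u) ab) /comp_at.
exact: amb_murphy.
Qed.

Lemma murphy_above i u : above i (amb u) -> above i (amb (murphy u)).
Proof.
move=> ab j lt_ij r; rewrite /comp_at amb_murphy.
exact: (jm_above (amb_highest u) ab lt_ij).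
Qed.

(** Both sides of the eigenvalue equation are compared at the lowest nonzero component, where X acts
    by the content of that row. *)
Lemma eigen_top d u : u != 0 -> murphy u = d *: u ->
  exists mu i, [/\ remrow mu la i, d = ct i, above i (amb u)
                 & rest i (amb u) != 0].
Proof.
move=> nz eig.
have [x ux] : exists x, amb u x != 0.
  apply/existsP; apply: contraNT nz => /existsPn h; apply/eqP/amb_inj/ffunP=> x.
  by apply/eqP/negbNE; rewrite [X in _ == X]ffunE h.
pose P i := [exists r, comp_at i (amb u) r != 0].
have Px : P (x ord_max).
  by apply/existsP; exists [ffun k => x (lift ord_max k)]; rewrite /comp_at -ext_restrict.
case: (arg_maxnP (fun i : 'I_m.+1 => i : nat) Px) => i /existsP[r nzr] maxi.
have ab : above i (amb u).
  move=> j lt_ij r'; apply/eqP; apply: contraTT lt_ij => nzj.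
  by rewrite -leqNgt; apply: maxi; apply/existsP; exists r'.
have [lt_row|le_row] := ltnP (rowlen la i.+1) (rowlen la i); last first.
  case/negP: nzr; apply/eqP.
  by apply: (top_nonremovable (amb_highest u) ab) => // k; apply: rowlen_out.
have [mu ri] := remrow_exists lt_row; exists mu, i; split=> //.
  have := murphy_top ab r; rewrite eig /comp_at.
  have -> : amb (d *: u) (ext r i) = d * amb u (ext r i) by rewrite /amb linearZ ffunE.
  exact: mulIf.
apply: contraNneq nzr => r0; apply/eqP.
exact: (rest_eq0 (amb_highest u).1 ri r0).
Qed.

(** X is triangular for the filtration with distinct contents on the diagonal, hence
    diagonalizable. *)
Lemma eigen_decomposition u : exists y : 'I_m.+1 -> S,
  (forall j, murphy (y j) = ct j *: y j) /\ u = \sum_j y j.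
Proof.
have main (i : nat) : (i <= m.+1)%N -> forall w : S,
    (forall j, (i <= j)%N -> forall r, comp_at j (amb w) r = 0) ->
    exists y : 'I_m.+1 -> S, [/\ forall j, murphy (y j) = ct j *: y j,
      forall j, (i <= j)%N -> y j = 0 & w = \sum_j y j].
  elim: i => [_ w w0|i IHi lt_i w ab].
    exists (fun=> 0); split=> // [j|]; first by rewrite linear0 scaler0.
    rewrite big1 //; apply/amb_inj/ffunP=> x; rewrite (ext_restrict x).
    by rewrite [LHS]w0 // [RHS]ffunE.
  pose i' := Ordinal lt_i; have ab' : above i' (amb w) by [].
  have [j le_ij r|y [eig y0 Ew]] := IHi (ltnW lt_i) (murphy w - ct i *: w).
    have -> : comp_at j (amb (murphy w - ct i *: w)) r =
        comp_at j (amb (murphy w)) r - ct i * comp_at j (amb w) r.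
      by rewrite /comp_at /amb linearB linearZ !ffunE /= [_ *: - _]mulrN.
    move: le_ij; rewrite leq_eqVlt => /orP[/eqP Ej|lt_ij].
      have -> : j = i' by apply/val_inj.
      by rewrite murphy_top // subrr.
    by rewrite (murphy_above ab') // ab // mulr0 subrr.
  (* Dividing the eigencomponents of (X - ct i) w by ct j - ct i gives those of w for j != i; w
     minus their sum is then an eigenvector for ct i. At j = i the inverse is 0, and so is [y j]. *)
  pose z j := (ct j - ct i)^-1 *: y j.
  have eig_z j : murphy (z j) = ct j *: z j.
    by rewrite linearZ /= eig scalerA mulrC -scalerA.
  exists (fun j => if j == i' then w - \sum_(k | k != i') z k else z j).
  split=> [j|j lt_ij|].
  - case: eqP => [->|_] //; rewrite linearB /=.
    rewrite [murphy (\sum_(k | _) _)]linear_sum /= scalerBr.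
    rewrite -[murphy w](subrK (ct i *: w)) Ew addrAC [LHS]addrC; congr (_ + _).
    rewrite (bigD1 i') //= y0 // add0r scaler_sumr -sumrB -sumrN.
    apply: eq_bigr => k neq.
    have -> : y k = (ct k - ct i) *: z k.
      rewrite scalerA mulfV ?scale1r // subr_eq0.
      by apply: contraNneq neq => /content_inj e; apply/eqP/val_inj.
    by rewrite eig_z scalerBl addrAC subrr add0r.
  - by rewrite -val_eqE /= gtn_eqF // /z y0 ?scaler0 // ltnW.
  rewrite (bigD1 i') //= eqxx -[LHS](subrK (\sum_(k | k != i') z k)).
  by congr (_ + _); apply: eq_bigr => k neq; rewrite (negbTE neq).
have [//|j|y [eig _ Eu]] := main m.+1 _ u; first by rewrite leqNgt ltn_ord.
by exists y.
Qed.

(** Lagrange interpolation: the product of the (X - ct j) / (c - ct j) over the contents other than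
    c. Being a polynomial in X, it is linear and commutes with S_(n-1), which the mere existence in
    [eigen_decomposition] does not give. *)
Definition eigenproj (c : C) u : S :=
  foldr (fun j (w : S) => if ct j == c then w else murphy_shift (c - ct j)^-1 (ct j) w)
    u (enum 'I_m.+1).

Lemma eigenproj_lin c : linear (eigenproj c).
Proof.
rewrite /eigenproj => a u w; elim: (enum _) => //= j s ->.
by case: eqP => // _; rewrite linearP.
Qed.
HB.instance Definition _ c :=
  GRing.isLinear.Build C S S _ (eigenproj c) (eigenproj_lin c).

Lemma eigenproj_emb c (s : 'S_m) u :
  eigenproj c (mact (emb s) u) = mact (emb s) (eigenproj c u).
Proof.
rewrite /eigenproj; elim: (enum _) => //= j t ->; case: eqP => // _.
by rewrite murphy_shift_emb.
Qed.

Lemma eigenproj_murphy c u : eigenproj c (murphy u) = murphy (eigenproj c u).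
Proof.
by rewrite /eigenproj; elim: (enum _) => //= j t ->; case: eqP; rewrite ?murphy_shiftC.
Qed.

Lemma eigenproj_id c y : murphy y = c *: y -> eigenproj c y = y.
Proof.
move=> eig; rewrite /eigenproj; elim: (enum _) => //= j t ->; case: eqP => // /eqP neq.
by rewrite (murphy_shift_eig _ _ eig) mulVf ?scale1r // subr_eq0 eq_sym.
Qed.

Lemma eigenproj0 c i y : murphy y = ct i *: y -> ct i != c -> eigenproj c y = 0.
Proof.
move=> eig neq; rewrite /eigenproj.
have : i \in enum 'I_m.+1 by rewrite mem_enum.
elim: (enum _) => //= j t IHt; rewrite inE => /orP[/eqP <-|/IHt ->]; last first.
  by case: ifP => // _; rewrite linear0.
rewrite (negbTE neq); set w := foldr _ _ _.
suff Ew : @murphy C m S w = ct i *: (w : S).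
  by rewrite (murphy_shift_eig _ _ Ew) subrr mulr0 scale0r.
rewrite /w; elim: t {IHt w} => //= k t IHt; case: eqP => // _.
by rewrite -murphy_shiftC IHt linearZ.
Qed.

Lemma eigenproj_eig c u : murphy (eigenproj c u) = c *: eigenproj c u.
Proof.
have [y [eig ->]] := eigen_decomposition u.
rewrite [eigenproj _ _]linear_sum [LHS]linear_sum scaler_sumr.
apply: eq_bigr => j _ /=.
have [<-|neq] := eqVneq (ct j) c; first by rewrite (eigenproj_id (eig j)).
by rewrite (eigenproj0 (eig j) neq) linear0 scaler0.
Qed.

Lemma eigenproj_sum u : u = \sum_(j < m.+1) eigenproj (ct j) u.
Proof.
have [y [eig Eu]] := eigen_decomposition u.
rewrite {1}Eu; apply: eq_bigr => j _; rewrite Eu linear_sum (bigD1 j) //=.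
rewrite eigenproj_id // big1 ?addr0 // => k neq; apply: (eigenproj0 (eig k)).
by apply: contraNneq neq => /content_inj e; apply/eqP/val_inj.
Qed.

(** On component i, X acts by ct i, so each interpolation factor acts there as 1. *)
Lemma eigenproj_top i u : above i (amb u) ->
  forall r, comp_at i (amb (eigenproj (ct i) u)) r = comp_at i (amb u) r.
Proof.
move=> ab; rewrite /eigenproj.
set w := foldr _ _ _; suff [] : above i (amb (w : S)) /\
  forall r, comp_at i (amb (w : S)) r = comp_at i (amb u) r by [].
rewrite {}/w; elim: (enum _) => //= j t; set w := foldr _ _ _ => -[ab_w Ew].
case: eqP => // /eqP neq.
have shiftE l r : comp_at l (amb (murphy_shift (ct i - ct j)^-1 (ct j) (w : S))) r =
    (ct i - ct j)^-1 *
    (comp_at l (amb (@murphy C m S w)) r - ct j * comp_at l (amb (w : S)) r).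
  rewrite /comp_at /murphy_shift /amb linearZ linearB !ffunE /=.
  by congr (_ * (_ - _)); rewrite linearZ ffunE.
split=> [l lt_il r|r]; rewrite shiftE.
  by rewrite (murphy_above ab_w) // ab_w // mulr0 subrr mulr0.
by rewrite murphy_top // -mulrBl mulKf ?Ew // subr_eq0 eq_sym.
Qed.

(** By [eigen_top] a nonzero eigenvector for ct i has its lowest nonzero component in row i, so
    taking that component is injective on the eigenspace; [specht_lift] makes it onto S^mu. *)
Lemma branch_row (mu : intpart m) i : remrow mu la i ->
  exists p : 'Hom(S, specht C mu), exists q : 'Hom(specht C mu, S),
  [/\ forall s u, p (mact (emb s) u) = mact s (p u),
      forall w, p (q w) = w,
      forall w, murphy (q w) = ct i *: q w,
      forall u, p (murphy u) = ct i *: p u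
    & forall u, p u = 0 -> eigenproj (ct i) u = 0].
Proof.
move=> ri.
have ab_eig y : murphy y = ct i *: y -> above i (amb y).
  move=> eig; have [->|nz] := eqVneq y 0.
    by move=> j _ r; rewrite /comp_at ffunE.
  have [nu [j [_ /content_inj e ab _]]] := eigen_top nz eig.
  by have -> : i = j by apply/val_inj.
pose pf u := vsproj (specht_space C mu) (rest i (amb (eigenproj (ct i) u))).
have ambp u : amb (pf u : specht C mu) = rest i (amb (eigenproj (ct i) u)).
  apply: vsprojK; apply/specht_kernel; apply: (rest_highest _ _ ri).
    exact: amb_highest.
  exact/ab_eig/eigenproj_eig.
have pf_lin : linear pf by move=> a u w; rewrite /pf /amb !linearP.
pose pl := GRing.isLinear.Build C S (specht C mu) _ pf pf_lin.
pose pL : {linear S -> specht C mu} := HB.pack pf pl.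
pose p : 'Hom(S, specht C mu) := linfun pL.
have pE u : amb (p u) = rest i (amb (eigenproj (ct i) u)) by rewrite lfunE; apply: ambp.
have p_eig u : p (eigenproj (ct i) u) = p u.
  apply: amb_inj; rewrite !pE.
  by rewrite [eigenproj _ (eigenproj _ _)]eigenproj_id // eigenproj_eig.
have p_ker u : p u = 0 -> eigenproj (ct i) u = 0.
  move=> pu0; apply/eqP; apply: contraTT isT => nz.
  have [nu [j [_ /content_inj e _ /negP[]]]] := eigen_top nz (eigenproj_eig (ct i) u).
  have <- : i = j by apply/val_inj.
  by rewrite -pE pu0.
have p_surj w : exists u, p u = w.
  have [v [Sv ab Ev]] := specht_lift ri (subvsP w).
  exists (Subvs Sv); apply: amb_inj; rewrite pE -[RHS]Ev.
  have /(_ (Subvs Sv) ab) top := @eigenproj_top i.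
  by apply/ffunP=> r; rewrite !ffunE; apply: top.
(* Any linear right inverse of p will do once projected to the eigenspace, because p does not see
   the projection ([p_eig]). *)
pose q := (linfun (eigenproj (ct i)) \o p^-1)%VF.
have qE w : q w = eigenproj (ct i) ((p^-1)%VF w) by rewrite comp_lfunE lfunE.
have p_full : limg p = fullv.
  apply/vspaceP=> w; rewrite memvf; have [u <-] := p_surj w.
  by rewrite memv_img ?memvf.
exists p, q; split=> // [s u|w|w|u].
- by apply: amb_inj; rewrite pE eigenproj_emb amb_act rest_emb -pE.
- by rewrite qE p_eig limg_lfunVK // p_full memvf.
- by rewrite qE eigenproj_eig.
by rewrite -p_eig eigenproj_murphy eigenproj_eig linearZ /= p_eig.
Qed.

Lemma branching_rule :
  exists p : forall mu, 'Hom(S, specht C mu), exists q : forall mu, 'Hom(specht C mu, S),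
    (forall u, (forall mu, prec mu la -> p mu u = 0) -> u = 0) /\
    forall mu, prec mu la ->
    [/\ forall s u, p mu (mact (emb s) u) = mact s (p mu u),
        forall w, p mu (q mu w) = w,
        forall w, murphy (q mu w) = (residue la mu)%:~R *: q mu w
      & forall u, p mu (murphy u) = (residue la mu)%:~R *: p mu u].
Proof.
have ex (mu : intpart m) : exists pq : 'Hom(S, specht C mu) * 'Hom(specht C mu, S),
    forall i, remrow mu la i ->
    [/\ forall s u, pq.1 (mact (emb s) u) = mact s (pq.1 u),
        forall w, pq.1 (pq.2 w) = w,
        forall w, murphy (pq.2 w) = ct i *: pq.2 w,
        forall u, pq.1 (murphy u) = ct i *: pq.1 u
      & forall u, pq.1 u = 0 -> eigenproj (ct i) u = 0].
  have [/prec_remrow[i ri]|nprec] := boolP (prec mu la).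
    have [p [q h]] := branch_row ri; exists (p, q) => j rj.
    by rewrite -(remrow_inj ri rj).
  by exists (0, 0) => i /remrow_prec; rewrite (negbTE nprec).
have [pq h] := fin_all_exists ex.
exists (fun mu => (pq mu).1), (fun mu => (pq mu).2); split=> [u u0|mu].
  rewrite [LHS]eigenproj_sum big1 // => i _; apply/eqP; apply: contraT => nz.
  have [mu [j [rj /content_inj e _ _]]] := eigen_top nz (eigenproj_eig (ct i) u).
  have Eij : i = j by apply/val_inj.
  case/negP: nz; rewrite Eij; have [_ _ _ _ ->//] := h mu j rj.
  exact/u0/remrow_prec/rj.
case/prec_remrow=> i ri; rewrite -(content_residue C ri).
by have [] := h mu i ri.
Qed.

End Branching.

(** * Supermodules *)

Lemma residue_removed m (mu : intpart m) la b : removed mu la b ->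
  residue la mu = Posz b.2 - Posz b.1.
Proof. by case/removed_remrow=> ri e; rewrite (residueE ri) e; have := ri.1; lia. Qed.

Lemma prec_conj m (mu : intpart m) la : prec mu la ->
  prec (conj_part mu) (conj_part la) /\
  residue (conj_part la) (conj_part mu) = - residue la mu.
Proof.
case/existsP=> -[i j] rb; have [b_la /eqP e] := andP rb.
have rb' : removed (conj_part mu) (conj_part la) (j, i).
  rewrite /removed mem_diag_conj b_la; apply/eqP/setP=> -[k l].
  rewrite mem_diag_conj e [RHS]in_setD1 mem_diag_conj in_setD1 !xpair_eqE.
  by congr (~~ _ && _); rewrite andbC.
split; first by apply/existsP; exists (j, i).
by rewrite (residue_removed rb) (residue_removed rb') opprB.
Qed.

Lemma residue_inj m (mu nu : intpart m) la : prec mu la -> prec nu la ->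
  residue la mu = residue la nu -> mu = nu.
Proof.
move=> /prec_remrow[i ri] /prec_remrow[j rj]; rewrite (residueE ri) (residueE rj) => e.
suff Eij : i = j by apply: remrow_fun ri _; rewrite Eij.
apply/val_inj; have := @row_decr _ la i j; have := @row_decr _ la j i.
by move: e => /=; lia.
Qed.

Section BranchingTheory.
Variables (C : numClosedFieldType) (m : nat) (la : intpart m.+1).
Local Notation S := (specht C la).
Variables (p : forall mu : intpart m, 'Hom(S, specht C mu))
          (q : forall mu : intpart m, 'Hom(specht C mu, S)).
Hypothesis p_inj : forall u, (forall mu, prec mu la -> p mu u = 0) -> u = 0.
Hypothesis pq_spec : forall mu, prec mu la ->
    [/\ forall s u, p mu (mact (emb s) u) = mact s (p mu u),
        forall w, p mu (q mu w) = w,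
        forall w, murphy (q mu w) = (residue la mu)%:~R *: q mu w
      & forall u, p mu (murphy u) = (residue la mu)%:~R *: p mu u].
Implicit Types (mu nu : intpart m).

(** X acts by different residues on the two sides; this stands in for Schur's lemma. *)
Lemma proj_sect0 mu nu w : prec mu la -> prec nu la -> nu != mu ->
  p nu (q mu w) = 0.
Proof.
move=> pmu pnu neq; have [_ _ eig _] := pq_spec pmu; have [_ _ _ pX] := pq_spec pnu.
apply/eqP; have /eqP := pX (q mu w); rewrite eig linearZ /= -subr_eq0 -scalerBl.
rewrite scaler_eq0 => /orP[|//]; rewrite subr_eq0 => /eqP/intr_inj e.
by case/eqP: neq; apply: residue_inj pnu pmu (esym e).
Qed.

Lemma proj_sum u : u = \sum_(mu | prec mu la) q mu (p mu u).
Proof.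
apply/eqP; rewrite -subr_eq0; apply/eqP/p_inj => mu pmu.
have [_ pq _ _] := pq_spec pmu.
rewrite linearB linear_sum (bigD1 mu) //= pq big1 ?addr0 ?subrr // => nu /andP[pnu neq].
by rewrite proj_sect0 // eq_sym.
Qed.

(** q comes from an arbitrary linear right inverse, but the maps [p nu] are equivariant and jointly
    detect vectors. *)
Lemma sect_equivariant mu : prec mu la ->
  @equivariant C m (specht C mu) (res_mod S) (q mu).
Proof.
move=> pmu s w; apply/eqP; rewrite -subr_eq0; apply/eqP/p_inj => nu pnu.
have [pE _ _ _] := pq_spec pnu; rewrite linearB /= pE.
have [->|neq] := eqVneq nu mu.
  by have [_ pq _ _] := pq_spec pmu; rewrite !pq subrr.
by rewrite !proj_sect0 // linear0 subrr.
Qed.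

Section Twist.
Variable T : 'Hom(S, S).
Hypothesis T_sgn : forall (s : 'S_m.+1) u, T (mact s u) = (-1) ^+ s *: mact s (T u).
Hypothesis la_self : la = conj_part la.

Lemma twist_murphy u : T (murphy u) = - murphy (T u).
Proof.
rewrite linear_sum -sumrN; apply: eq_bigr => k _.
by rewrite /= T_sgn odd_tperm eq_sym neq_lift expr1 scaleN1r.
Qed.

Lemma prec_conj_self mu : prec mu la ->
  prec (conj_part mu) la /\ residue la (conj_part mu) = - residue la mu.
Proof. by move=> /prec_conj; rewrite -la_self. Qed.

Lemma proj_twist_sect0 mu nu w : prec mu la -> prec nu la -> nu != conj_part mu ->
  p nu (T (q mu w)) = 0.
Proof.
move=> pmu pnu neq; have [_ _ eig _] := pq_spec pmu; have [_ _ _ pX] := pq_spec pnu.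
have [pmu' Eres] := prec_conj_self pmu.
apply/eqP; have /eqP := pX (T (q mu w)); rewrite -[murphy _]opprK -twist_murphy eig.
rewrite linearZ linearN linearZ /= -scaleNr -subr_eq0 -scalerBl -rmorphN /=.
rewrite scaler_eq0 => /orP[|//]; rewrite subr_eq0 -Eres => /eqP/intr_inj e.
by case/eqP: neq; apply: residue_inj pnu pmu' (esym e).
Qed.

Lemma proj_twist mu u : prec mu la ->
  p mu (T u) = p mu (T (q (conj_part mu) (p (conj_part mu) u))).
Proof.
move=> pmu; have [pmu' _] := prec_conj_self pmu.
rewrite [in LHS](proj_sum u) !linear_sum (bigD1 (conj_part mu)) //=.
rewrite [X in _ + X]big1 ?addr0 // => nu /andP[pnu neq].
by rewrite proj_twist_sect0 //; apply: contraNneq neq => ->; rewrite conjK.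
Qed.

End Twist.
End BranchingTheory.

(** * Even homomorphisms into direct sums *)

Section EvenMaps.
Variables (C : numFieldType) (n : nat).
Implicit Types V W : supermod C n.

Definition even_hom V W (f : 'Hom(V, W)) :=
  equivariant f /\ forall b u, u \in spart V b -> f u \in spart W b.

Lemma hom_bij (aT rT : vectType C) (f : 'Hom(aT, rT)) :
  (forall v, f v = 0 -> v = 0) -> (forall w, exists v, f v = w) -> bijective f.
Proof.
move=> inj surj; have ker0 : lker f == 0%VS.
  apply/eqP/vspaceP=> v; rewrite memv_ker memv0.
  by apply/eqP/eqP => [/inj|->]; rewrite ?linear0.
exists (f^-1)%VF; first exact: lker0_lfunK.
by move=> w; have [v <-] := surj w; rewrite lker0_lfunK.
Qed.

Lemma pair_hom (V W1 W2 : vectType C) (f : 'Hom(V, W1)) (g : 'Hom(V, W2)) :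
  exists h : 'Hom(V, (W1 * W2)%type), forall v, h v = (f v, g v).
Proof.
pose h v := (f v, g v).
have h_lin : linear h by move=> c u v; rewrite /h !linearP.
pose hm := GRing.isLinear.Build C V (W1 * W2)%type _ h h_lin.
pose hL : {linear V -> (W1 * W2)%type} := HB.pack h hm.
by exists (linfun hL) => v; rewrite lfunE.
Qed.

Lemma fst_hom (V W : vectType C) :
  exists f : 'Hom((V * W)%type, V), forall x, f x = x.1.
Proof. by exists (linfun fst) => x; rewrite lfunE. Qed.

Lemma snd_hom (V W : vectType C) :
  exists f : 'Hom((V * W)%type, W), forall x, f x = x.2.
Proof. by exists (linfun snd) => x; rewrite lfunE. Qed.

Lemma dsum_hom V W1 W2 (f : 'Hom(V, W1)) (g : 'Hom(V, W2)) :
  even_hom f -> even_hom g ->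
  exists2 h : 'Hom(V, dsum W1 W2), even_hom h & forall v, h v = (f v, g v).
Proof.
move=> [fs fe] [gs ge]; have [h hE] := pair_hom f g; exists h => //.
split=> [s u|b u ub]; first by rewrite !hE fs gs.
by rewrite hE mem_dsum_part /= fe ?ge.
Qed.

(** Q is an index set containing P: preimages are also made to vanish under every [h j] with [Q j]
    outside the sum, so that sums over disjoint index sets can be reached independently. *)
Lemma dsum_big_hom V (I : eqType) (s : seq I) (P : pred I) (W : I -> supermod C n)
    (h : forall i, 'Hom(V, W i)) :
  uniq s -> (forall i, P i -> even_hom (h i)) ->
  exists f : 'Hom(V, \big[@dsum C n/super0 C n]_(i <- s | P i) W i),
  [/\ even_hom f,
      forall v, f v = 0 <-> (forall i, i \in s -> P i -> h i v = 0)
    & forall Q : pred I, (forall i, P i -> Q i) ->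
      (forall i w, P i -> exists v, h i v = w /\ forall j, Q j -> j != i -> h j v = 0) ->
      forall x, exists v, f v = x /\ forall j, Q j -> ~~ ((j \in s) && P j) -> h j v = 0].
Proof.
move=> + h_even; elim: s => [_|i s IHs /andP[i_s uniq_s]].
  rewrite big_nil; exists 0; split=> [|v|Q _ _ x].
  - split=> [t u|b u _]; first by rewrite !lfunE.
    by rewrite lfunE mem0v.
  - by split=> // _; rewrite lfunE.
  exists 0; split=> [|j _ _]; last by rewrite linear0.
  by rewrite linear0; apply/esym; apply: thinmx0.
have [f [f_even f_ker f_surj]] := IHs uniq_s; rewrite big_cons.
case Pi: (P i); last first.
  exists f; split=> // [v|Q PQ hQ x].
    rewrite f_ker; split=> v0 j; last by move=> js; apply: v0; rewrite inE js orbT.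
    by rewrite inE => /orP[/eqP ->|js]; [rewrite Pi|apply: v0].
  have [v [fv v0]] := f_surj Q PQ hQ x; exists v; split=> // j Qj njs.
  apply: v0 => //; apply: contra njs => /andP[js Pj].
  by rewrite inE js orbT.
have [g g_even gE] := dsum_hom (h_even i Pi) f_even.
exists g; split=> // [v|Q PQ hQ [w x]].
  rewrite gE; split=> [[hv fv] j|v0].
    rewrite inE => /orP[/eqP -> //|js]; exact: (f_ker v).1.
  rewrite v0 ?mem_head // (f_ker v).2 // => j js; apply: v0.
  by rewrite inE js orbT.
have [v1 [hv1 v1_0]] := hQ i w Pi; have [v2 [fv2 v2_0]] := f_surj Q PQ hQ x.
exists (v1 + v2); split=> [|j Qj njs].
  rewrite gE !linearD /= hv1 fv2 v2_0 ?PQ // ?(negbTE i_s) // addr0 (f_ker v1).2 ?add0r //.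
  move=> j js Pj; apply: v1_0; first exact: PQ.
  by apply: contraNneq i_s => <-.
have neq : j != i by apply: contraNneq njs => ->; rewrite mem_head Pi.
rewrite linearD /= v1_0 // v2_0 ?addr0 //.
by apply: contra njs => /andP[js Pj]; rewrite inE js orbT.
Qed.

End EvenMaps.

(** * The associating maps and the modules of pairs *)

Section Associates.
Variables (C : numClosedFieldType) (phi : assoc_family C).

Lemma specht_cast n (la nu : intpart n) : la = nu ->
  exists k : 'Hom(specht C la, specht C nu), forall u, amb (k u) = amb u.
Proof. by move=> <-; exists \1%VF => u; rewrite id_lfunE. Qed.

Lemma ambZ n (la : intpart n) c (u : specht C la) : amb (c *: u) = c *: amb u.
Proof. exact: linearZ. Qed.

Lemma phi_inverse n (la : intpart n) :
  exists psi : 'Hom(specht C (conj_part la), specht C la),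
  [/\ forall u, psi (phi n la u) = u, forall w, phi n la (psi w) = w
    & forall s w, psi (mact s w) = (-1) ^+ s *: mact s (psi w)].
Proof.
have [k kE] := specht_cast (conjK la).
pose psi := (k \o phi n (conj_part la))%VF.
have psiE w : amb (psi w) = amb (phi n (conj_part la) w) by rewrite comp_lfunE kE.
have psiK u : psi (phi n la u) = u by apply: amb_inj; rewrite psiE phi_inv.
exists psi; split=> // [w|s w].
  by have [u <-] := phi_surj phi w; rewrite psiK.
have [u <-] := phi_surj phi w; rewrite psiK -[RHS]psiK; congr (psi _).
by rewrite linearZ /= phi_sgn scalerA -signr_addb addbb scale1r.
Qed.

Lemma phi_self n (la : intpart n) : la = conj_part la ->
  exists T : 'Hom(specht C la, specht C la),
  [/\ forall u, amb (T u) = amb (phi n la u), forall u, T (T u) = u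
    & forall s u, T (mact s u) = (-1) ^+ s *: mact s (T u)].
Proof.
move=> la_self; have [k kE] := specht_cast (esym la_self).
pose T := (k \o phi n la)%VF.
have TE w : amb (T w) = amb (phi n la w) by rewrite comp_lfunE kE.
exists T; split=> // [u|s u].
  by apply: amb_inj; rewrite TE (phi_cast phi la_self (TE u)) phi_inv.
by apply: amb_inj; rewrite TE phi_sgn !ambZ !amb_act TE.
Qed.

Lemma W_gen_self n (la : intpart n) : la = conj_part la ->
  exists e, W_gen phi la = W_self phi (la := la) e.
Proof. by move=> la_self; rewrite /W_gen; case: eqP => // e; exists e. Qed.

Lemma W_gen_pair n (la : intpart n) : la != conj_part la -> W_gen phi la = W_pair phi la.
Proof. by rewrite /W_gen; case: eqP. Qed.

Lemma W_genE n (la : intpart n.+2) : W phi la = W_gen phi la.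
Proof. by []. Qed.

Definition summand n (mu : intpart n) : supermod C n :=
  if mu == conj_part mu then dsum (W phi mu) (Pi (W phi mu)) else W phi mu.

(* The domain stands for S^mu + sgn S^mu graded by the swap of the summands;
   this is W^mu, or W^mu + Pi W^mu when mu = mu'. *)
Definition doubling_map n (mu : intpart n) (T : supermod C n)
    (g : 'Hom((specht C mu * specht C mu)%type, T)) :=
  [/\ forall x, g x = 0 -> x = 0,
      forall y, exists x, g x = y,
      forall s a b, g (mact s a, (-1) ^+ s *: mact s b) = mact s (g (a, b))
    & forall (b : bool) a, g (a, (-1) ^+ b *: a) \in spart T b].

Lemma doubling_pair n (mu : intpart n) : exists g, @doubling_map n mu (W_pair phi mu) g.
Proof.
have [p1 p1E] := fst_hom (specht C mu) (specht C mu).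
have [p2 p2E] := snd_hom (specht C mu) (specht C mu).
have [g gP] := pair_hom p1 (phi n mu \o p2)%VF.
have gE a b : g (a, b) = (a, phi n mu b) by rewrite gP comp_lfunE p1E p2E.
exists g; split=> [[a b]|[a c]|s a b|b a]; rewrite ?gE.
- case=> -> b0; congr pair; apply: (@phi_inj _ phi _ mu).
  by rewrite linear0.
- by have [b Eb] := phi_surj phi c; exists (a, b); rewrite gE Eb.
- by congr pair; rewrite linearZ /= phi_sgn scalerA -signr_addb addbb scale1r.
by apply/pair_partP; exists a; rewrite /graph linearZ.
Qed.

(** The map is (a, b) to (a + Tb, a - Tb): for b = a or b = -a the two entries lie in opposite
    eigenspaces of T, and Pi evens out their degrees. *)
Lemma doubling_self n (mu : intpart n) (e : mu = conj_part mu) :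
  exists g, @doubling_map n mu (dsum (W_self phi e) (Pi (W_self phi e))) g.
Proof.
have h2 : (2%:R : C) != 0 by rewrite pnatr_eq0.
have [T [TE TK T_sgn]] := phi_self e.
have [p1 p1E] := fst_hom (specht C mu) (specht C mu).
have [p2 p2E] := snd_hom (specht C mu) (specht C mu).
have [g gP] := pair_hom (p1 + (T \o p2))%VF (p1 - (T \o p2))%VF.
have gE a b : g (a, b) = (a + T b, a - T b).
  by rewrite gP !lfun_simp /= p1E p2E.
have half (u : specht C mu) : 2%:R^-1 *: u + 2%:R^-1 *: u = u.
  by rewrite -scalerDl -mulr2n -[_ *+ 2]mulr_natl mulfV // scale1r.
exists g; split=> [[a b]|[x y]|s a b|b a].
- rewrite gE => g0; have Ea : a + T b = 0 := congr1 fst g0.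
  have Eb : a - T b = 0 := congr1 snd g0.
  have Tb0 : T b = 0.
    move/eqP: Eb; rewrite -[a](addrK (T b)) Ea sub0r -opprD oppr_eq0 -mulr2n.
    by rewrite -scaler_nat scaler_eq0 (negbTE h2) => /eqP.
  by move: Ea; rewrite Tb0 addr0 => ->; rewrite -[b]TK Tb0 linear0.
- exists (2%:R^-1 *: (x + y), T (2%:R^-1 *: (x - y))); rewrite gE TK.
  rewrite -scalerDr -scalerBr opprB addrACA subrr addr0 [x + y]addrC addrACA subrr addr0.
  by rewrite !scalerDr !half.
- rewrite !gE linearZ /= T_sgn scalerA -signr_addb addbb scale1r.
  by congr pair; rewrite ?linearD ?linearN.
rewrite gE mem_dsum_part /= linearZ /=; apply/andP; split; apply/self_partP.
  rewrite -TE linearD linearZ /= TK -ambZ scalerDr scalerA -signr_addb addbb.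
  by rewrite scale1r addrC.
rewrite -TE linearB linearZ /= TK -ambZ signrN scaleNr scalerBr opprB scalerA.
by rewrite -signr_addb addbb scale1r addrC.
Qed.

Lemma intpart1_eq (mu nu : intpart 1) : mu = nu.
Proof.
have row (la : intpart 1) k : rowlen la k = (k == 0)%N.
  case: k => [|k]; last by rewrite rowlen_out.
  by have := sum_rowlen la; rewrite big_ord1.
by apply: rowlen_inj => k; rewrite !row.
Qed.

Lemma specht1_line (mu : intpart 1) : exists e : 'Hom(specht C mu, C^o),
  [/\ forall u, e u = 0 -> u = 0, forall c, exists u, e u = c
    & forall s u, e (mact s u) = e u].
Proof.
pose r0 : {ffun 'I_1 -> 'I_1} := [ffun=> ord0].
have rE r : r = r0 by apply/ffunP=> k; rewrite ffunE ord1.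
pose ef (u : specht C mu) : C^o := amb u r0.
have ef_lin : linear ef by move=> c u v; rewrite /ef /amb linearP !ffunE.
pose em := GRing.isLinear.Build C (specht C mu) C^o _ ef ef_lin.
pose eL : {linear specht C mu -> C^o} := HB.pack ef em.
have eE u : linfun eL u = amb u r0 by rewrite lfunE.
exists (linfun eL); split=> [u|c|s u]; rewrite ?eE.
- move=> u0; apply/amb_inj/ffunP=> r.
  by rewrite (rE r) [LHS]u0 [RHS]ffunE.
- pose v : ambient C 1 := [ffun=> c].
  have Sv : v \in specht_space C mu.
    apply/specht_kernel; split=> [r _ i|j i]; last by rewrite !ord1.
    rewrite ord1; have := sum_rowlen mu; rewrite big_ord1 => ->.
    rewrite /cnt -[RHS](card_ord 1); apply: eq_card => k.
    by rewrite !inE (rE r) ffunE.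
  by exists (Subvs Sv); rewrite eE /amb /= ffunE.
by rewrite amb_act ffunE; congr (amb u _); apply: rE.
Qed.

(** W^(1) is even by convention, whatever the sign of phi^(1), so the identity takes the place of
    phi here. *)
Lemma doubling_one (mu : intpart 1) :
  exists g, @doubling_map 1 mu (dsum (super_triv1 C) (Pi (super_triv1 C))) g.
Proof.
have h2 : (2%:R : C) != 0 by rewrite pnatr_eq0.
have [e [e_inj e_surj e_act]] := specht1_line mu.
have sgn1 (s : 'S_1) : (-1) ^+ s = 1 :> C.
  by have -> : s = 1%g; [apply/permP=> k; rewrite !ord1|rewrite odd_perm1].
have [p1 p1E] := fst_hom (specht C mu) (specht C mu).
have [p2 p2E] := snd_hom (specht C mu) (specht C mu).
have [g gP] := pair_hom (e \o (p1 + p2))%VF (e \o (p1 - p2))%VF.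
have gE a b : g (a, b) = (e (a + b), e (a - b)).
  by rewrite gP !lfun_simp /= p1E p2E.
have half (u : specht C mu) : 2%:R^-1 *: u + 2%:R^-1 *: u = u.
  by rewrite -scalerDl -mulr2n -[_ *+ 2]mulr_natl mulfV // scale1r.
exists g; split=> [[a b]|[x y]|s a b|b a].
- rewrite gE => g0; have /e_inj Ea : e (a + b) = 0 := congr1 fst g0.
  have /e_inj Eb : e (a - b) = 0 := congr1 snd g0.
  have b0 : b = 0.
    move/eqP: Eb; rewrite -[a](addrK b) Ea sub0r -opprD oppr_eq0 -mulr2n.
    by rewrite -scaler_nat scaler_eq0 (negbTE h2) => /eqP.
  by move: Ea; rewrite b0 addr0 => ->.
- have [u <-] := e_surj x; have [w <-] := e_surj y.
  exists (2%:R^-1 *: (u + w), 2%:R^-1 *: (u - w)); rewrite gE.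
  rewrite -scalerDr -scalerBr opprB addrACA subrr addr0 [u + w]addrC addrACA subrr addr0.
  by rewrite !scalerDr !half.
- by rewrite !gE sgn1 scale1r -linearD -linearB /= !e_act.
rewrite gE mem_dsum_part /=; case: b; rewrite ?expr0 ?expr1 ?scale1r ?scaleN1r.
  by rewrite subrr linear0 mem0v memvf.
by rewrite subrr linear0 mem0v memvf.
Qed.

Lemma summand_doubling n (mu : intpart n.+1) : exists g, @doubling_map _ mu (summand mu) g.
Proof.
rewrite /summand; case: n => [|n] in mu *.
  by rewrite (intpart1_eq (conj_part mu) mu) eqxx; apply: doubling_one.
rewrite !W_genE; have [e|neq] := eqVneq mu (conj_part mu).
  by have [e' ->] := W_gen_self e; apply: doubling_self.
by rewrite W_gen_pair //; apply: doubling_pair.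
Qed.

End Associates.

(** * The two restriction formulas *)

Section Restriction.
Variables (C : numClosedFieldType) (phi : assoc_family C) (m : nat).
Implicit Types (mu : intpart m.+1) (la : intpart m.+2).

Lemma restriction_E la : la != conj_part la ->
  even_iso (res_super (W phi la))
    (dsum
       (\big[@dsum C m.+1 / super0 C m.+1]_(mu |
           prec mu la && (mu != conj_part mu)) W phi mu)
       (\big[@dsum C m.+1 / super0 C m.+1]_(mu | prec mu la && (mu == conj_part mu))
          dsum (W phi mu) (Pi (W phi mu)))).
Proof.
move=> la_neq; rewrite W_genE W_gen_pair //; set V := res_super _.
have [p [q [p_inj pq]]] := branching_rule C la.
have [psi [psiK phiK psi_sgn]] := phi_inverse phi la.
have ex mu : exists h : 'Hom(V, summand phi mu), prec mu la ->
    [/\ even_hom h,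
        forall x, h x = 0 <-> p mu x.1 = 0 /\ p mu (psi x.2) = 0
      & forall w, exists a b, forall x, p mu x.1 = a -> p mu (psi x.2) = b -> h x = w].
  have [g [g_inj g_surj g_sgn g_even]] := summand_doubling phi mu.
  have [p1 p1E] := fst_hom (specht C la) (specht C (conj_part la)).
  have [p2 p2E] := snd_hom (specht C la) (specht C (conj_part la)).
  have [k kP] := pair_hom (p mu \o p1)%VF (p mu \o psi \o p2)%VF.
  have hE x : (g \o k)%VF x = g (p mu x.1, p mu (psi x.2)).
    by rewrite comp_lfunE kP !comp_lfunE p1E p2E.
  exists (g \o k)%VF => pmu; have [pE _ _ _] := pq mu pmu.
  split=> [|x|w].
  - split=> [s x|b x].
      rewrite !hE -g_sgn /= psi_sgn linearZ /= !pE.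
      by rewrite odd_lift_perm addbb.
    by case/pair_partP=> u ->; rewrite hE /= linearZ /= psiK linearZ /=.
  - rewrite hE; split=> [/g_inj[] //|[-> ->]].
    exact: (linear0 g).
  have [[a b] <-] := g_surj w; exists a, b => x ea eb.
  by rewrite hE ea eb.
have [h hP] := fin_all_exists ex.
pose P1 mu := prec mu la && (mu != conj_part mu).
pose P2 mu := prec mu la && (mu == conj_part mu).
have h1 mu : P1 mu -> even_hom (h mu) by case/andP=> /hP[].
have h2 mu : P2 mu -> even_hom (h mu) by case/andP=> /hP[].
have [f1 [f1_even f1_ker f1_surj]] := dsum_big_hom (index_enum_uniq _) h1.
have [f2 [f2_even f2_ker f2_surj]] := dsum_big_hom (index_enum_uniq _) h2.
have hQ mu w : prec mu la -> exists v, h mu v = w /\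
    forall nu, prec nu la -> nu != mu -> h nu v = 0.
  move=> pmu; have [_ _ /(_ w)[a [b hw]]] := hP mu pmu.
  have [_ pqK _ _] := pq mu pmu.
  exists (q mu a, phi _ la (q mu b)); split=> [|nu pnu neq].
    by apply: hw; rewrite /= ?psiK pqK.
  have [_ hker _] := hP nu pnu; apply/hker.
  by rewrite /= psiK !(proj_sect0 pq).
have P1Q mu : P1 mu -> prec mu la by case/andP.
have P2Q mu : P2 mu -> prec mu la by case/andP.
rewrite [X in dsum X](eq_bigr (@summand C phi m.+1)); last first.
  by move=> mu /andP[_ /negbTE neq]; rewrite /summand neq.
rewrite [X in dsum _ X](eq_bigr (@summand C phi m.+1)); last first.
  by move=> mu /andP[_ e]; rewrite /summand e.
have [f [f_eq f_even] fE] := dsum_hom f1_even f2_even.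
exists f; split=> //; apply: hom_bij => [v|[x1 x2]].
  rewrite fE => f0; have /f1_ker v1 : f1 v = 0 := congr1 fst f0.
  have /f2_ker v2 : f2 v = 0 := congr1 snd f0.
  have h0 mu : prec mu la -> p mu v.1 = 0 /\ p mu (psi v.2) = 0.
    move=> pmu; have [_ hker _] := hP mu pmu; apply/hker.
    have [e|neq] := eqVneq mu (conj_part mu).
      by apply: v2; rewrite ?mem_index_enum // /P2 pmu -e eqxx.
    by apply: v1; rewrite ?mem_index_enum // /P1 pmu neq.
  have v10 : v.1 = 0 by apply: p_inj => mu /h0[].
  have v20 : v.2 = 0.
    by rewrite -[v.2]phiK (p_inj (psi v.2)) ?linear0 // => mu /h0[].
  by case: v v10 v20 {f0 v1 v2 h0} => a b /= -> ->.
(* With all mu below la as Q, a preimage for one sum is sent to zero in the other. *)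
have [u [fu u0]] := f1_surj _ P1Q (fun mu w Pmu => hQ mu w (P1Q mu Pmu)) x1.
have [w [fw w0]] := f2_surj _ P2Q (fun mu w Pmu => hQ mu w (P2Q mu Pmu)) x2.
exists (u + w); rewrite fE !linearD /= fu fw.
have -> : f1 w = 0.
  apply/f1_ker => mu _ Pmu; apply: w0; first exact: P1Q.
  by apply/negP => /andP[_ /andP[_ e]]; case/andP: Pmu => _; rewrite e.
have -> : f2 u = 0.
  apply/f2_ker => mu _ Pmu; apply: u0; first exact: P2Q.
  by apply/negP => /andP[_ /andP[_ /negP[]]]; case/andP: Pmu.
by rewrite addr0 add0r.
Qed.

End Restriction.

(** For n >= 3 every W^mu is built from phi^mu, so coherence applies; n = 2 has no self-conjugate
    partition. *)
Lemma restriction_F (C : numClosedFieldType) (phi : assoc_family C) m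
    (la : intpart m.+3) : la = conj_part la ->
  even_iso (res_super (W phi la))
    (\big[@dsum C m.+2 / super0 C m.+2]_(mu |
        prec mu la && (0 <= residue la mu)) W phi mu).
Proof.
move=> la_self; rewrite W_genE; have [e ->] := W_gen_self phi la_self.
set V := res_super _; have [p [q [p_inj pq]]] := branching_rule C la.
have [T [TE TK T_sgn]] := phi_self phi la_self.
have partT b (u : V) : u \in spart V b -> T u = (-1) ^+ b *: u.
  by move/self_partP => Eu; apply: amb_inj; rewrite TE Eu ambZ.
have pconj mu : prec mu la -> prec (conj_part mu) la /\
    residue la (conj_part mu) = - residue la mu := @prec_conj_self _ _ la_self mu.
pose P mu := prec mu la && (0 <= residue la mu).
have ex mu : exists h : 'Hom(V, W phi mu), P mu ->
    [/\ even_hom h,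
        forall v, h v = 0 <-> p mu v = 0 /\ p mu (T v) = 0
      & forall w, exists v, h v = w /\
          forall nu, P nu -> nu != mu -> p nu v = 0 /\ p nu (T v) = 0].
  have [/andP[pmu res_ge0]|nP] := boolP (P mu); last by exists 0.
  have [pE pqK _ _] := pq mu pmu; have [pmu' res_mu'] := pconj mu pmu.
  have [mu_self|neq] := eqVneq mu (conj_part mu); last first.
    have := summand_doubling phi mu; rewrite /summand (negbTE neq).
    move=> [g [g_inj g_surj g_sgn g_even]].
    (* Residue 0 would give mu and mu' the same residue, hence mu = mu'. *)
    have res_gt0 : 0 < residue la mu.
      rewrite lt_def res_ge0 andbT; apply: contraNneq neq => res0.
      by apply/eqP/(residue_inj pmu pmu'); rewrite res_mu' res0 oppr0.
    have [k kP] := pair_hom (p mu) (p mu \o T)%VF.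
    have hE v : (g \o k)%VF v = g (p mu v, p mu (T v)).
      by rewrite !comp_lfunE kP comp_lfunE.
    exists (g \o k)%VF => _; split=> [|v|w].
    - split=> [s v|b v vb].
        by rewrite !hE -g_sgn T_sgn linearZ /= !pE odd_lift_perm addbb.
      by rewrite hE (partT b) // linearZ /=.
    - rewrite hE; split=> [/g_inj[] //|[-> ->]].
      exact: (linear0 g).
    (* [T (q mu b)] lies over mu' and is invisible to [p mu], while T brings it back to [q mu b]; so
       the two entries are prescribed independently. *)
    have [[a b] <-] := g_surj w; exists (q mu a + T (q mu b)).
    have ET : T (q mu a + T (q mu b)) = T (q mu a) + q mu b by rewrite linearD /= TK.
    split=> [|nu /andP[pnu res_nu] neq_nu].
      rewrite hE ET !linearD /= !pqK !(proj_twist_sect0 pq T_sgn la_self) //.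
      by rewrite addr0 add0r.
    have neq' : nu != conj_part mu.
      by apply: contraTneq res_nu => ->; rewrite res_mu' -ltNge oppr_lt0.
    rewrite ET !linearD /= !(proj_twist_sect0 pq T_sgn la_self) //.
    by rewrite !(proj_sect0 pq) // addr0.
  have [Tm [TmE TmK Tm_sgn]] := phi_self phi mu_self.
  have [e' EW] := W_gen_self phi mu_self; rewrite W_genE EW.
  (* Without coherence this would only hold up to sign, and the summand could be Pi W^mu. *)
  have TqE w : T (q mu w) = q mu (Tm w).
    apply: amb_inj; rewrite TE.
    apply: (phi_coh pmu mu_self la_self (i := q mu)) => [x y||]; last by rewrite TmE.
      by move/(congr1 (p mu)); rewrite !pqK.
    exact: (sect_equivariant p_inj pq pmu).
  have pT v : p mu (T v) = Tm (p mu v).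
    by rewrite (proj_twist p_inj pq T_sgn la_self) // -mu_self TqE pqK.
  exists (p mu) => _; split=> [|v|w].
  - split=> [s v|b v vb]; first exact: pE.
    apply/self_partP; rewrite -TmE -pT (partT b) // linearZ /=.
    exact: ambZ.
  - by split=> [v0|[]//]; rewrite pT v0 linear0.
  exists (q mu w); split=> [|nu /andP[pnu _] neq]; first exact: pqK.
  by rewrite (proj_sect0 pq) // (proj_twist_sect0 pq T_sgn la_self) -?mu_self.
have [h hP] := fin_all_exists ex.
have h_even mu : P mu -> even_hom (h mu) by case/hP.
have [f [[f_eq f_even] f_ker f_surj]] := dsum_big_hom (index_enum_uniq _) h_even.
exists f; split=> //; apply: hom_bij => [v /f_ker v0|x].
  have h0 mu : P mu -> p mu v = 0 /\ p mu (T v) = 0.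
    by move=> Pmu; have [_ hker _] := hP mu Pmu; apply/hker/v0; rewrite ?mem_index_enum.
  apply: (p_inj v) => mu pmu; have [ge0|lt0] := leP 0 (residue la mu).
    by have [] := h0 mu; rewrite /P ?pmu.
  have [pmu' res_mu'] := pconj mu pmu.
  (* A component of negative residue is determined by the component of [T v] at the conjugate, whose
     residue is positive. *)
  rewrite -[v]TK (proj_twist p_inj pq T_sgn la_self) //.
  have [|_ ->] := h0 (conj_part mu); last by rewrite !linear0.
  by rewrite /P pmu' res_mu' oppr_ge0 ltW.
have [//|mu w Pmu|v [fv _]] := f_surj P _ _ x; last by exists v.
have [_ _ /(_ w)[v [hv v0]]] := hP mu Pmu; exists v; split=> // nu Pnu neq.
by have [_ hker _] := hP nu Pnu; apply/hker/v0.
Qed.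

Lemma intpart2_not_self (la : intpart 2) : la <> conj_part la.
Proof.
move=> e; have := ltn_row_conj la 0 1; rewrite -e.
have := sum_rowlen la; rewrite big_ord_recr big_ord1 /=.
have := @row_decr _ la 0 1 isT; lia.
Qed.

(* n is m.+1 and the field of complex numbers is R[i]. *)
Theorem corollary3p4p2 (R : realType) (phi : assoc_family R[i]) (m : nat)
    (Pbar : {set intpart m.+1}) (la : intpart m.+1) :
  (2 <= m.+1)%N -> conj_reps Pbar -> la \in Pbar ->
  (la \in E_ Pbar ->
     even_iso (res_super (W phi la))
       (dsum
          (\big[@dsum R[i] m / super0 R[i] m]_(mu : intpart m |
              prec mu la && (mu != conj_part mu)) W phi mu)
          (\big[@dsum R[i] m / super0 R[i] m]_(mu : intpart m |
              prec mu la && (mu == conj_part mu))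
             dsum (W phi mu) (Pi (W phi mu)))))
  /\
  (la \in F_ Pbar ->
     even_iso (res_super (W phi la))
       (\big[@dsum R[i] m / super0 R[i] m]_(mu : intpart m |
           prec mu la && (0 <= residue la mu)) W phi mu)).
Proof.
case: m => [//|m] in Pbar la * => _ _ _; split; rewrite inE => /andP[_].
  exact: restriction_E.
move/eqP; case: m => [|m] in Pbar la * => [/intpart2_not_self //|].
exact: restriction_F.
Qed.
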